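(* There exists a singular Rajchman probability $\nu$ on $\mathbb T$ such that all its convolution powers $\nu^k$, $k\ge1$, are singular (so $P_\nu$ is not Harris) and $P_\nu$ is hyperbounded.
   Context: $\mathbb T$ is the circle group, identified with $[-\pi,\pi)$, with normalized Haar (Lebesgue) measure $\mu$; $L^p=L^p(\mathbb T,\mu)$. Singular means singular with respect to $\mu$. For a probability $\nu$ on $\mathbb T$, $P_\nu f(x)=\nu*f(x)=\int_{\mathbb T}f(x-y)\,d\nu(y)$; it is a Markov operator with invariant probability $\mu$, a contraction of every $L^p$. $P_\nu$ is hyperbounded if it maps $L^p$ into $L^q$ for some $1<p<q\le\infty$. $\hat\nu(n)=\int e^{-inx}\,d\nu(x)$; $\nu$ is Rajchman if $\hat\nu(n)\to0$ as $|n|\to\infty$. $\nu^k$ is the $k$-fold convolution $\nu*\cdots*\nu$. $P_\nu$ is Harris (recurrent) exactly when some convolution power $\nu^k$ is not singular. *)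

(* Defs.v *)
From HB Require Import structures.
From mathcomp Require Import all_boot all_order all_algebra.
From mathcomp Require Import archimedean ring lra.
From mathcomp Require Import all_classical all_reals all_analysis.
From mathcomp Require Import measurable_realfun complex.

Set Implicit Arguments.
Unset Strict Implicit.
Unset Printing Implicit Defensive.

Import Order.TTheory GRing.Theory Num.Theory.
Import numFieldNormedType.Exports.

Local Open Scope classical_set_scope.
Local Open Scope ring_scope.

(* The circle group R / (2 pi Z), each class being represented by its unique
   element in [-pi, pi). *)
Record circle (R : realType) := Circle {
  cval : R ;
  cvalP : - pi <= cval < pi }.

HB.instance Definition _ (R : realType) := [isSub for @cval R].
HB.instance Definition _ (R : realType) := [Choice of circle R by <:].

Section circle_group.
Variable R : realType.
Implicit Types (x y : R) (a b c : circle R).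

Definition turns x : int := Num.floor ((x + pi) / (pi *+ 2)).

Lemma twopi_gt0 : 0 < pi *+ 2 :> R.
Proof. by rewrite pmulrn_lgt0// pi_gt0. Qed.

Lemma wrap_subproof x :
  - pi <= x - (turns x)%:~R * (pi *+ 2) < (pi : R).
Proof.
have h := twopi_gt0.
have /andP[] := mem_rg1_floor ((x + pi) / (pi *+ 2)).
rewrite -/(turns x) ler_pdivlMr// ltr_pdivrMr// mulrDl mul1r => h1 h2.
by apply/andP; split; lra.
Qed.

(* The quotient map R -> R / (2 pi Z). *)
Definition wrap x : circle R := Circle (wrap_subproof x).

Lemma wrap_eq x y (k : int) : y = x + k%:~R * (pi *+ 2) -> wrap x = wrap y.
Proof.
move=> ->; apply: val_inj => /=.
have -> : turns (x + k%:~R * (pi *+ 2)) = turns x + k.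
  rewrite /turns addrAC mulrDl mulfK ?gt_eqF ?twopi_gt0//.
  by rewrite floorDrz ?intr_int// intrKfloor.
by rewrite intrD mulrDl; ring.
Qed.

Lemma cvalK a : wrap (cval a) = a.
Proof.
apply: val_inj => /=; have /andP[a1 a2] := cvalP a.
suff -> : turns (cval a) = 0 by rewrite mul0r subr0.
apply/floor_def; rewrite ler_pdivlMr ?ltr_pdivrMr ?twopi_gt0// -mulr_natr.
by apply/andP; split; lra.
Qed.

Definition cadd a b := wrap (cval a + cval b).
Definition copp a := wrap (- cval a).

Lemma caddA : associative cadd.
Proof.
move=> a b c; apply: (@wrap_eq _ _ (turns (cval b + cval c)
  - turns (cval a + cval b))).
by rewrite /= intrB; ring.
Qed.

Lemma caddC : commutative cadd.
Proof. by move=> a b; rewrite /cadd addrC. Qed.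

Lemma cadd0 : left_id (wrap 0) cadd.
Proof.
move=> a; rewrite -[RHS]cvalK; apply: (@wrap_eq _ _ (turns 0)).
by rewrite /=; ring.
Qed.

Lemma caddN : left_inverse (wrap 0) copp cadd.
Proof.
move=> a; apply: (@wrap_eq _ _ (turns (- cval a))).
by rewrite /=; ring.
Qed.

HB.instance Definition _ :=
  GRing.isZmodule.Build (circle R) caddA caddC cadd0 caddN.
HB.instance Definition _ := isPointed.Build (circle R) (0 : circle R).

End circle_group.

(* Borel sets of the circle: traces of the Borel sets of R. *)
HB.instance Definition _ (R : realType) := Measurable.copy (circle R)
  (g_sigma_algebra_preimageType (@cval R : circle R -> measurableTypeR R)).

Section circle_measurability.
Variable R : realType.

Lemma measurable_cval : measurable_fun setT (@cval R).
Proof. by move=> _ B mB; exists B. Qed.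

Lemma measurable_wrap : measurable_fun setT (@wrap R).
Proof.
move=> _ _ [B mB <-]; rewrite !setTI -comp_preimage -[X in measurable X]setTI.
suff : measurable_fun setT (@cval R \o @wrap R) by apply.
rewrite (_ : _ \o _ = fun x => x - (turns x)%:~R * (pi *+ 2)) //.
apply: measurable_funB => //; apply: measurable_funM => //.
apply: nondecreasing_measurable => // x y xy.
rewrite ler_int le_floor// ler_pM2r ?lerD2r// invr_gt0.
exact: twopi_gt0.
Qed.

HB.instance Definition _ := isMeasurableFun.Build _ _ _ _
  (@wrap R : measurableTypeR R -> circle R) measurable_wrap.

Definition circle_add (ab : circle R * circle R) : circle R := ab.1 + ab.2.

Lemma measurable_circle_add : measurable_fun setT circle_add.
Proof.
apply: (measurableT_comp measurable_wrap).
by apply: measurable_funD; apply: (measurableT_comp measurable_cval).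
Qed.

HB.instance Definition _ :=
  isMeasurableFun.Build _ _ _ _ circle_add measurable_circle_add.

End circle_measurability.

Section circle_measures.
Variable R : realType.
Local Notation T := (circle R).

Lemma Npi_lt_pi : - pi < pi :> R.
Proof. by rewrite gtrN// pi_gt0. Qed.

(* Normalized Lebesgue measure on [-pi, pi], carried to the circle (the
   endpoints are identified by [wrap]). *)
Definition haar : probability T R :=
  distribution (uniform_prob Npi_lt_pi) (@wrap R).

Definition singular_measures d (U : measurableType d)
    (m1 m2 : {measure set U -> \bar R}) :=
  exists A : set U, [/\ measurable A, m1 A = 0%E & m2 (~` A) = 0%E].

Definition singular (nu : probability T R) := singular_measures nu haar.

Definition conv (nu rho : probability T R) : probability T R :=
  distribution (nu \x rho)%E (@circle_add R).

(* [convpow nu k] is the [k]-fold convolution power, the [0]-th one being the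
   Dirac mass at the neutral element. *)
Definition convpow (nu : probability T R) (k : nat) : probability T R :=
  iter k (conv nu) (\d_(0 : T) : probability T R).

(* For [f] in L^p(haar) the integral converges for haar-almost every [x]; the
   default value of [Rintegral] is used on the remaining null set. *)
Definition convop (nu : probability T R) (f : T -> R) : T -> R :=
  fun x => (\int[nu]_y f (x - y))%R.

Definition hyperbounded (nu : probability T R) :=
  exists p q : \bar R, [/\ (1 < p)%E, (p < q)%E &
    forall f : T -> R, f \in Lfun haar p -> convop nu f \in Lfun haar q].

(* Harris recurrence of the random walk operator [convop nu], in the form it
   takes for convolution operators. *)
Definition harris (nu : probability T R) :=
  exists2 k : nat, (1 <= k)%N & ~ singular (convpow nu k).

(* The integral of exp(-inx), split into real and imaginary parts. *)
Definition fourier_coef (nu : probability T R) (n : int) : R[i] :=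
  Complex (\int[nu]_x cos (n%:~R * cval x))%R
          (- (\int[nu]_x sin (n%:~R * cval x)))%R.

Definition rajchman (nu : probability T R) :=
  forall e : R, 0 < e -> exists N : nat,
    forall n : int, (N <= `|n|)%N -> `|fourier_coef nu n| < (e%:C)%C.

End circle_measures.

(* Main.v *)
(** Let nu be the law of 2 pi (sum of xi_j / 3^(j+1)), where the digits xi_j in
    {-1, 0, 1} are independent, xi_j is 0 with probability (1 + 2 e_j) / 3 and
    each of 1, -1 with probability (1 - e_j) / 3, and the bias e_j, at most 1/2,
    tends to 0 more slowly than any negative power of j.

    The Fourier coefficients of nu are explicit products, which tend to 0
    because e_j does.  The coefficient at 3^m is at least e_m / 2, and the
    characters of frequencies 3^m and 3^l are correlated by O(3^-|m - l|) under
    nu^k.  So the lacunary sums S_N of the cos (3^m x), m < N, have variance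
    O(N) under nu^k and under the Haar measure, with mean 0 under the latter but
    a mean of larger order than sqrt N under nu^k: by Chebyshev's inequality
    and the Borel-Cantelli lemma, S_N separates the two measures.

    Hyperboundedness, from L^2 to L^4: for e <= 1/2, the averaging operator on
    three points with weights (1 - e) / 3, (1 + 2 e) / 3, (1 - e) / 3 is a
    contraction from L^2 to L^4.  By Minkowski's inequality these contractions
    compose along the subgroups 3^-n Z / Z, carries being mere translations;
    smoothing at scale 3^-n and letting n tend to infinity gives
    ||nu * f||_4 <= ||f||_2. *)

Require Import Defs.
From mathcomp Require Import all_boot all_order all_algebra.
From mathcomp Require Import all_classical all_reals all_analysis.
From HB Require Import structures.
From mathcomp Require Import archimedean ring lra.
From mathcomp Require Import measurable_realfun complex.

Set Implicit Arguments.
Unset Strict Implicit.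
Unset Printing Implicit Defensive.

Import Order.TTheory GRing.Theory Num.Theory.
Import numFieldNormedType.Exports.

Local Open Scope classical_set_scope.
Local Open Scope ring_scope.

(** * Averages of bounded functions over the unit interval *)

(** Two demands pull the bias in opposite directions. The Fourier coefficients can vanish at
    infinity only if [e_j] does, while the k-th power is told from Haar measure by a mean of order N
    e_N^k, which must outgrow sqrt N for every k. A logarithmic decay meets both. Independent digits
    are realised without a product space: all are read off one uniform variable, by cutting [0, 1]
    into three pieces of the prescribed lengths, rescaling, and repeating. The laws obey an exact
    one-digit recursion, from which come both the product formula for the coefficients and the
    factorization of the operator into digit averages. The finite contractions only compare means
    over a single coset of 3^-n Z / Z, and the mean of f^2 over one coset says nothing about its
    integral. Averaging f first over intervals of length 3^-n repairs this: the translates of such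
    an interval along a coset tile the circle, so the coset mean becomes the integral, at every
    point. Nearly everything is proved for bounded functions, where integrability is automatic; L^2
    is reached last, by truncation and a second use of Fatou's lemma. *)

Section affine.
Variable R : realType.
Local Notation mu := (@lebesgue_measure R).

Definition affine (a p : R) (v : R) : R := a + p * v.

Lemma measurable_affine a p : measurable_fun setT (affine a p).
Proof. by apply: measurable_funD => //; apply: measurable_funM. Qed.

HB.instance Definition _ a p :=
  isMeasurableFun.Build _ _ _ _ (affine a p : measurableTypeR R -> measurableTypeR R)
   (@measurable_affine a p).

(** By uniqueness of Lebesgue measure: the rescaled pushforward gives half-open intervals their
    length. *)
Lemma lebesgue_measure_affine (a p : R) (A : set R) : 0 < p -> measurable A ->
  mu A = (p%:E * mu (affine a p @^-1` A))%E.
Proof.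
move=> p0 mA.
have -> : p%:E = (NngNum (ltW p0))%:num%:E by [].
have -> // := @lebesgue_measure_unique R
  (mscale (NngNum (ltW p0))
     (pushforward mu (affine a p : measurableTypeR R -> measurableTypeR R))).
move=> _ [[x y] /= _ <-]; rewrite /mscale/= /pushforward.
have -> : affine a p @^-1` `]x, y] = `](x - a) / p, (y - a) / p]%classic.
  apply/seteqP; split => v /=; rewrite !in_itv/= /affine.
    by rewrite ltr_pdivrMr// ler_pdivlMr// => /andP[? ?]; apply/andP; split; lra.
  by rewrite ltr_pdivrMr// ler_pdivlMr// => /andP[? ?]; apply/andP; split; lra.
rewrite !lebesgue_measure_itv/= !lte_fin ltr_pM2r ?invr_gt0// ltrD2r.
case: ifPn => _; last by rewrite mule0.
by rewrite -!EFinB -EFinM; congr EFin; field; lra.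
Qed.

Lemma ge0_integral_affine (a p : R) (G : R -> \bar R) : 0 < p ->
  measurable_fun setT G -> (forall x, 0 <= G x)%E ->
  (\int[mu]_(x in `[a, (a + p)%R]) G x =
   p%:E * \int[mu]_(v in `[0%R, 1%R]) G (a + p * v)%R)%E.
Proof.
move=> p0 mG G0.
have -> : `[0%R, 1%R]%classic = affine a p @^-1` `[a, a + p].
  apply/seteqP; split => v /=; rewrite !in_itv/= /affine => /andP[h1 h2];
    by apply/andP; split; nra.
have := @ge0_integral_pushforward _ _ (measurableTypeR R) (measurableTypeR R) R
  (affine a p) (@measurable_affine a p) mu `[a, a + p] G.
rewrite /comp /= => <- //; last exact: measurable_funS mG.
have -> : p%:E = (NngNum (ltW p0))%:num%:E by [].
rewrite -ge0_integral_mscale//; last exact: measurable_funS mG.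
apply: eq_measure_integral => A mA _.
exact: lebesgue_measure_affine.
Qed.

End affine.

(** A class stable under algebra, composition and partial integration, and integrable for every
    probability, so that linearity and Fubini carry no further side condition. *)
Definition bounded_measurable d (X : measurableType d) (R : realType)
  (f : X -> R) := measurable_fun setT f /\ exists M, forall x, `|f x| <= M.
Notation bdm := bounded_measurable.

Section bounded_measurable.
Context d (X : measurableType d) (R : realType).
Implicit Types f g : X -> R.

Lemma bdm_cst (c : R) : bdm (fun _ : X => c).
Proof. by split; [exact: measurable_cst | exists `|c|]. Qed.

Lemma bdmD f g : bdm f -> bdm g -> bdm (fun x => f x + g x).
Proof.
move=> [mf [M fM]] [mg [N gN]]; split; first exact: measurable_funD.
by exists (M + N) => x; rewrite (le_trans (ler_normD _ _))// lerD.
Qed.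

Lemma bdmN f : bdm f -> bdm (fun x => - f x).
Proof.
move=> [mf [M fM]]; split; first exact: measurableT_comp.
by exists M => x; rewrite normrN.
Qed.

Lemma bdmM f g : bdm f -> bdm g -> bdm (fun x => f x * g x).
Proof.
move=> [mf [M fM]] [mg [N gN]]; split; first exact: measurable_funM.
by exists (M * N) => x; rewrite normrM ler_pM.
Qed.

Lemma bdmX f n : bdm f -> bdm (fun x => f x ^+ n).
Proof.
move=> bf; elim: n => [|n IH].
  by under [X in bdm X]funext do rewrite expr0; exact: bdm_cst.
by under [X in bdm X]funext do rewrite exprS; exact: bdmM.
Qed.

Lemma bdmB f g : bdm f -> bdm g -> bdm (fun x => f x - g x).
Proof. by move=> bf bg; apply: bdmD => //; exact: bdmN. Qed.

Lemma bdm_sum (I : Type) (r : seq I) (F : I -> X -> R) :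
  (forall i, bdm (F i)) -> bdm (fun x => \sum_(i <- r) F i x).
Proof.
move=> bF; elim: r => [|i r IH].
  by under [X in bdm X]funext do rewrite big_nil; exact: bdm_cst.
by under [X in bdm X]funext do rewrite big_cons; exact: bdmD.
Qed.

Lemma bdm_comp d' (Y : measurableType d') (f : X -> R) (phi : Y -> X) :
  measurable_fun setT phi -> bdm f -> bdm (fun y => f (phi y)).
Proof.
by move=> mphi [mf [M fM]]; split; [exact: measurableT_comp | exists M].
Qed.

Variable P : probability X R.

Lemma bdm_integrable f : bdm f -> P.-integrable setT (EFin \o f).
Proof.
move=> [mf [M fM]]; apply: measurable_bounded_integrable => //.
  exact: fin_num_fun_lty.
exists M; split => [|N MN x _ /=]; first exact: num_real.
by rewrite (le_trans (fM x))// ltW.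
Qed.
Hint Resolve bdm_integrable : core.

Lemma mean_cst (c : R) : \int[P]_x c = c.
Proof.
rewrite Rintegral_cst//; transitivity (c * fine 1%E); last exact: mulr1.
by congr (_ * fine _); exact: probability_setT.
Qed.

Lemma meanD f g : bdm f -> bdm g ->
  \int[P]_x (f x + g x) = \int[P]_x f x + \int[P]_x g x.
Proof. by move=> bf bg; rewrite RintegralD//; exact: bdm_integrable. Qed.

Lemma meanB f g : bdm f -> bdm g ->
  \int[P]_x (f x - g x) = \int[P]_x f x - \int[P]_x g x.
Proof. by move=> bf bg; rewrite RintegralB//; exact: bdm_integrable. Qed.

Lemma meanZ (c : R) f : bdm f -> \int[P]_x (c * f x) = c * \int[P]_x f x.
Proof. by move=> bf; rewrite RintegralZl//; exact: bdm_integrable. Qed.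

Lemma mean_sum (I : Type) (r : seq I) (F : I -> X -> R) :
  (forall i, bdm (F i)) ->
  \int[P]_x (\sum_(i <- r) F i x) = \sum_(i <- r) \int[P]_x F i x.
Proof.
move=> bF; elim: r => [|i r IH].
  by rewrite big_nil; under eq_Rintegral do rewrite big_nil; rewrite mean_cst.
rewrite big_cons; under eq_Rintegral do rewrite big_cons.
by rewrite meanD ?IH//; exact: bdm_sum.
Qed.

Lemma mean_le f g : bdm f -> bdm g -> (forall x, f x <= g x) ->
  \int[P]_x f x <= \int[P]_x g x.
Proof. by move=> bf bg fg; apply: le_Rintegral => //; exact: bdm_integrable. Qed.

Lemma mean_normr_le f (M : R) : bdm f -> (forall x, `|f x| <= M) ->
  `|\int[P]_x f x| <= M.
Proof.
move=> bf fM; rewrite ler_norml; apply/andP; split.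
  rewrite -[leLHS](mean_cst (- M)); apply: mean_le => // [|x]; first exact: bdm_cst.
  by have := fM x; rewrite ler_norml => /andP[].
rewrite -[leRHS](mean_cst M); apply: mean_le => // [|x]; first exact: bdm_cst.
by have := fM x; rewrite ler_norml => /andP[].
Qed.

Lemma mean_EFin f : bdm f -> (\int[P]_x f x)%:E = (\int[P]_x (f x)%:E)%E.
Proof.
move=> bf; rewrite fineK//; apply: integrable_fin_num => //.
exact: bdm_integrable.
Qed.

(** The variance is nonnegative. *)
Lemma mean_sqr_le f : bdm f -> (\int[P]_x f x) ^+ 2 <= \int[P]_x (f x ^+ 2).
Proof.
move=> bf; set c := \int[P]_x f x.
have : 0 <= \int[P]_x ((f x - c) ^+ 2) by apply: Rintegral_ge0 => x _; exact: sqr_ge0.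
under eq_Rintegral.
  move=> x _.
  have -> : (f x - c) ^+ 2 = f x ^+ 2 + (- (2 * c) * f x + c ^+ 2) by ring.
  over.
have b1 : bdm (fun x => - (2 * c) * f x) by apply: bdmM => //; exact: bdm_cst.
rewrite meanD; [|exact: bdmX|by apply: bdmD => //; exact: bdm_cst].
rewrite meanD//; last exact: bdm_cst.
by rewrite mean_cst meanZ// -/c => h; lra.
Qed.

End bounded_measurable.

Section mean_distribution.
Context d d' (X : measurableType d) (Y : measurableType d') (R : realType).
Variable P : probability X R.

Lemma mean_distribution (phi : {mfun X >-> Y}) (f : Y -> R) : bdm f ->
  \int[distribution P phi]_y f y = \int[P]_x f (phi x).
Proof.
move=> bf; congr fine; rewrite integral_pushforward//=.
- by apply: measurableT_comp => //; exact: bf.1.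
- by apply: bdm_integrable; apply: bdm_comp => //.
Qed.

Variable Q : probability Y R.

Lemma bdm_fubini_l (f : X * Y -> R) : bdm f -> bdm (fun x => \int[Q]_y f (x, y)).
Proof.
move=> bf; split; last first.
  have [mf [M fM]] := bf; exists M => x; apply: mean_normr_le => //.
  by split; [exact: measurableT_comp | exists M].
apply: measurableT_comp => //.
by apply: (@measurable_fubini_F _ _ _ _ _ P Q (EFin \o f)); exact: bdm_integrable.
Qed.

End mean_distribution.

Section mean_fubini.
Context d d' (X : measurableType d) (Y : measurableType d') (R : realType).
Variables (P : probability X R) (Q : probability Y R).

Lemma mean_prod (f : X * Y -> R) : bdm f ->
  \int[(P \x Q)%E]_z f z = \int[P]_x \int[Q]_y f (x, y).
Proof.
move=> bf; congr fine.
rewrite -integral12_prod_meas1; last exact: bdm_integrable.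
apply: eq_integral => x _; rewrite mean_EFin//.
by apply: bdm_comp bf.
Qed.

Lemma mean_fubini (f : X -> Y -> R) : bdm (fun z => f z.1 z.2) ->
  \int[P]_x \int[Q]_y f x y = \int[Q]_y \int[P]_x f x y.
Proof.
move=> bf; congr fine.
have b1 x : bdm (f x) by exact: (bdm_comp (@pair1_measurable _ _ X Y x) bf).
have b2 y : bdm (f^~ y) by exact: (bdm_comp (@pair2_measurable _ _ X Y y) bf).
under eq_integral do rewrite mean_EFin//.
under [RHS]eq_integral do rewrite mean_EFin//.
by apply: (@Fubini _ _ _ _ _ P Q (fun z => (f z.1 z.2)%:E)); exact: bdm_integrable.
Qed.

End mean_fubini.

(** * Uniform measure and its splitting along a ternary partition *)

Section unit_interval.
Variable R : realType.
Local Notation RR := (measurableTypeR R).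
Local Notation mu := (@lebesgue_measure R).

Definition unif : probability RR R := uniform_prob (@ltr01 R).

Lemma ge0_integral_itvU (a b c : R) (G : R -> \bar R) : a <= b -> b <= c ->
  measurable_fun setT G -> (forall x, 0 <= G x)%E ->
  (\int[mu]_(x in `[a, c]) G x =
   \int[mu]_(x in `[a, b]) G x + \int[mu]_(x in `[b, c]) G x)%E.
Proof.
move=> ab bc mG G0.
rewrite (@itv_bndbnd_setU _ _ (BLeft a) (BLeft b) (BRight c)) ?bnd_simp//.
rewrite ge0_integral_setU//=; last 2 first.
- exact: measurable_funS mG.
- apply/disj_setPS => x [/=]; rewrite !in_itv/= => /andP[_ h1] /andP[h2 _].
  by move: h1; rewrite ltNge h2.
congr (_ + _)%E; rewrite integral_itv_bndo_bndc//.
exact: measurable_funS mG.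
Qed.

Lemma integral_unif (f : R -> \bar R) :
  measurable_fun setT f -> (forall x, 0 <= f x)%E ->
  (\int[unif]_x f x = \int[mu]_(x in `[0%R, 1%R]) f x)%E.
Proof. by move=> mf f0; rewrite integral_uniform// subr0 invr1 mul1e. Qed.

(** The point 1 is left out because the right endpoint of a piece of the partition belongs to the
    next piece, where the digit changes. *)
Lemma mean_unif_eq (f g : RR -> R) : bdm f -> bdm g ->
  (forall v, 0 <= v < 1 -> f v = g v) -> \int[unif]_v f v = \int[unif]_v g v.
Proof.
move=> bf bg fg; apply/eqP; rewrite -subr_eq0 -meanB// -normr_eq0.
have b : bdm (fun v => f v - g v) by exact: bdmB.
rewrite eq_le normr_ge0 andbT.
apply: le_trans (le_normr_Rintegral _ _) _ => //; first exact: bdm_integrable.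
rewrite /Rintegral integral_unif//; last first.
  by apply/measurable_EFinP; apply: measurableT_comp => //; exact: b.1.
rewrite -integral_itv_bndo_bndc; last first.
  apply/measurable_EFinP; apply: measurableT_comp => //.
  by apply: measurable_funS b.1.
rewrite integral0_eq// => v /=; rewrite in_itv/= => v01.
by rewrite fg// subrr normr0.
Qed.

Lemma bdm_affine (G : RR -> R) a p : bdm G -> bdm (fun v : RR => G (a + p * v)).
Proof. by apply: bdm_comp; exact: (@measurable_affine R a p). Qed.

Variable e : R.
Hypotheses (e0 : 0 <= e) (e1 : e < 1).

Definition sidew := (1 - e) / 3.
Definition midw := (1 + 2 * e) / 3.

Lemma sidew_gt0 : 0 < sidew.
Proof. by move: e1 => h; rewrite /sidew; lra. Qed.
Lemma midw_gt0 : 0 < midw.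
Proof. by move: e0 => h; rewrite /midw; lra. Qed.
Lemma weights1 : sidew + midw + sidew = 1. Proof. rewrite /sidew /midw; lra. Qed.

Lemma ge0_integral_unif_split (G : R -> \bar R) :
  measurable_fun setT G -> (forall x, 0 <= G x)%E ->
  (\int[unif]_u G u = sidew%:E * \int[unif]_v G (0 + sidew * v)%R +
    midw%:E * \int[unif]_v G (sidew + midw * v)%R +
    sidew%:E * \int[unif]_v G (sidew + midw + sidew * v)%R)%E.
Proof.
move=> mG G0.
have mGa a p : measurable_fun setT (fun v : RR => G (a + p * v)).
  by apply: (measurableT_comp mG); exact: measurable_affine.
have E (a p : R) : 0 < p -> (p%:E * \int[unif]_v G (a + p * v)%R =
    \int[mu]_(x in `[a, (a + p)%R]) G x)%E.
  move=> p0; rewrite integral_unif; [|exact: mGa|by move=> *; exact: G0].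
  exact: (esym (ge0_integral_affine a p0 mG G0)).
rewrite !E ?sidew_gt0 ?midw_gt0// add0r integral_unif//.
have -> : sidew + midw + sidew = 1 by exact: weights1.
have := weights1; have := sidew_gt0; have := midw_gt0 => m0 s0 w1.
by rewrite -!ge0_integral_itvU//; lra.
Qed.

Lemma mean_unif_split (G : RR -> R) : bdm G ->
  \int[unif]_u G u = sidew * \int[unif]_v G (0 + sidew * v) +
    midw * \int[unif]_v G (sidew + midw * v) +
    sidew * \int[unif]_v G (sidew + midw + sidew * v).
Proof.
move=> bG; have [mG [M GM]] := bG.
have bGa a p : bdm (fun v : RR => G (a + p * v)) by exact: bdm_affine.
have M0 x : 0 <= G x + M.
  by have := GM x; rewrite ler_norml => /andP[? _]; lra.
have bM (H : RR -> R) : bdm H -> bdm (fun x => H x + M).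
  by move=> bH; apply: bdmD => //; exact: bdm_cst.
(* Adding the bound [M] reduces to the nonnegative case; since the weights sum to 1, it adds the
   same constant to both sides. The same device returns below for Haar means and translations. *)
have key (H : RR -> R) : bdm H -> \int[unif]_u (H u + M) = \int[unif]_u H u + M.
  by move=> bH; rewrite meanD ?mean_cst//; exact: bdm_cst.
have : (\int[unif]_u (G u + M))%:E =
  (sidew * \int[unif]_v (G (0 + sidew * v) + M) +
    midw * \int[unif]_v (G (sidew + midw * v) + M) +
    sidew * \int[unif]_v (G (sidew + midw + sidew * v) + M))%:E.
  rewrite !EFinD !EFinM !mean_EFin//; try exact: bM.
  rewrite (@ge0_integral_unif_split (fun x => (G x + M)%:E))//.
  by apply/measurable_EFinP; apply: measurable_funD.
rewrite !key// => -[]; have := weights1 => h1 h2.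
apply: (addIr M); rewrite {}h2 -[in RHS](mul1r M) -h1; ring.
Qed.

Lemma mean_unif_piecewise (G F1 F2 F3 : RR -> R) :
  bdm G -> bdm F1 -> bdm F2 -> bdm F3 ->
  (forall v, 0 <= v < 1 -> G (sidew * v) = F1 v) ->
  (forall v, 0 <= v < 1 -> G (sidew + midw * v) = F2 v) ->
  (forall v, 0 <= v < 1 -> G (sidew + midw + sidew * v) = F3 v) ->
  \int[unif]_u G u = sidew * \int[unif]_v F1 v + midw * \int[unif]_v F2 v +
    sidew * \int[unif]_v F3 v.
Proof.
move=> bG b1 b2 b3 h1 h2 h3; rewrite mean_unif_split//.
congr (_ * _ + _ * _ + _ * _); apply: mean_unif_eq => //; try exact: bdm_affine.
by move=> v v01; rewrite add0r h1.
Qed.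

End unit_interval.

(** * Random ternary digits *)

Section digits.
Variable R : realType.
Local Notation RR := (measurableTypeR R).
Local Notation E f := (\int[unif R]_v f v).

(* The digits are shifted by one, so that partial expansions increase with their
   length; [phi] below is recentred. *)
Definition digit (e u : R) : R :=
  if u < sidew e then 0 else if u < sidew e + midw e then 1 else 2.

(** The expanding map of the partition: each piece is stretched onto the unit interval. For a
    uniform [u] the image is uniform and independent of [digit e u], so iteration yields independent
    digits. *)
Definition digit_shift (e u : R) : R :=
  if u < sidew e then u / sidew e
  else if u < sidew e + midw e then (u - sidew e) / midw e
  else (u - sidew e - midw e) / sidew e.

Lemma measurable_digit e : measurable_fun setT (digit e : RR -> R).
Proof.
apply: measurable_fun_if => //; first exact: measurable_fun_ltr.
apply: measurable_funTS; apply: measurable_fun_if => //.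
exact: measurable_fun_ltr.
Qed.

Lemma measurable_digit_shift e : measurable_fun setT (digit_shift e : RR -> RR).
Proof.
have m3 (a b c : R) : measurable_fun setT (fun u : RR => (u - a - b) / c : RR).
  by apply: measurable_funM => //; apply: measurable_funB => //; exact: measurable_funB.
apply: measurable_fun_if => //; first exact: measurable_fun_ltr.
  by apply: measurable_funTS; exact: measurable_funM.
apply: measurable_funTS; apply: measurable_fun_if => //.
- exact: measurable_fun_ltr.
- by apply: measurable_funTS; apply: measurable_funM => //; exact: measurable_funB.
- exact: measurable_funTS.
Qed.

Variable e : nat -> R.
Hypothesis e01 : forall j, 0 <= e j < 1.

Fixpoint expansion (n j : nat) (u : R) : R :=
  if n is n'.+1 then (digit (e j) u + expansion n' j.+1 (digit_shift (e j) u)) / 3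
  else 0.

Lemma digit_bounds x u : 0 <= digit x u <= 2.
Proof.
by rewrite /digit; case: ifP => _; [|case: ifP => _]; apply/andP; split; lra.
Qed.

Lemma expansion_bounds n j u : 0 <= expansion n j u <= 1.
Proof.
elim: n j u => [|n IH] j u /=; first by apply/andP; split; lra.
have /andP[] := IH j.+1 (digit_shift (e j) u); have /andP[] := digit_bounds (e j) u.
by move=> *; apply/andP; split; lra.
Qed.

Lemma expansion_nd j u : nondecreasing_seq (fun n => expansion n j u).
Proof.
apply/nondecreasing_seqP => n; elim: n j u => [|n IH] j u.
  by have /andP[] := expansion_bounds 1 j u.
rewrite [leLHS]/= [leRHS]/=; have := IH j.+1 (digit_shift (e j) u) => /=.
by move=> h; lra.
Qed.

Lemma expansion_cvg j u : cvgn (fun n => expansion n j u).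
Proof.
apply: nondecreasing_is_cvgn; first exact: expansion_nd.
by exists 1 => _ [n _ <-]; have /andP[] := expansion_bounds n j u.
Qed.

Lemma measurable_expansion n j : measurable_fun setT (expansion n j : RR -> R).
Proof.
elim: n j => [|n IH] j /=; first exact: measurable_cst.
apply: measurable_funM => //; apply: measurable_funD; first exact: measurable_digit.
exact: (measurableT_comp (IH _) (measurable_digit_shift _)).
Qed.

(** The subtracted 1/2 is the sum of the 3^-(i+1), which undoes the shift of the digits by one. *)
Definition phi (j : nat) (u : R) : R := limn (fun n => expansion n j u) - 1 / 2.

Lemma phi_rec j u : phi j u = (digit (e j) u - 1 + phi j.+1 (digit_shift (e j) u)) / 3.
Proof.
rewrite /phi; set l := limn (fun n => expansion n j.+1 _).
suff -> : limn (fun n => expansion n j u) = (digit (e j) u + l) / 3 by lra.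
apply/cvg_lim => //; rewrite -(cvg_shiftS _ _) /=.
apply: cvgM; last exact: cvg_cst.
apply: cvgD; first exact: cvg_cst.
exact: expansion_cvg.
Qed.

Lemma phi_bound j u : `|phi j u| <= 1 / 2.
Proof.
have h0 : 0 <= limn (fun n => expansion n j u).
  apply: limr_ge; first exact: expansion_cvg.
  by apply: nearW => n; have /andP[] := expansion_bounds n j u.
have h1 : limn (fun n => expansion n j u) <= 1.
  apply: limr_le; first exact: expansion_cvg.
  by apply: nearW => n; have /andP[] := expansion_bounds n j u.
by rewrite /phi ler_norml; apply/andP; split; lra.
Qed.

Lemma measurable_phi j : measurable_fun setT (phi j : RR -> RR).
Proof.
apply: measurable_funB => //.
apply: (@measurable_fun_cvg _ _ _ _ (fun n => expansion n j : RR -> R)) => //.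
  by move=> n; exact: measurable_expansion.
by move=> u _; exact: expansion_cvg.
Qed.

(** Conditioning on the digit of index [j]: the law of [phi j] is a mixture of three copies, scaled
    by 1/3, of the law of [phi j.+1]. Besides this recursion, only the bound 1/2 and measurability
    of [phi] are used later. *)
Lemma mean_phi_rec j (f : RR -> R) : bdm f ->
  E (fun u => f (phi j u)) =
    sidew (e j) * E (fun u => f ((phi j.+1 u - 1) / 3)) +
    midw (e j) * E (fun u => f (phi j.+1 u / 3)) +
    sidew (e j) * E (fun u => f ((phi j.+1 u + 1) / 3)).
Proof.
move=> bf; have /andP[e0 e1] := e01 j.
have s0 := sidew_gt0 e1; have m0 := midw_gt0 e0; have w1 := weights1 (e j).
have bphi k (c : R) : bdm (fun u : RR => f ((phi k u + c) / 3)).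
  apply: (@bdm_comp _ _ _ _ _ f (fun u : RR => (phi k u + c) / 3)) bf.
  apply: measurable_funM => //; apply: measurable_funD => //.
  exact: measurable_phi.
apply: (mean_unif_piecewise e0 e1).
- by apply: bdm_comp bf; exact: measurable_phi.
- exact: (bphi j.+1 (- 1)).
- have := bphi j.+1 0.
  by under [X in bdm X -> _]funext do rewrite addr0.
- exact: (bphi j.+1 1).
- move=> v /andP[v0 v1]; rewrite phi_rec /digit /digit_shift.
  have -> : sidew (e j) * v < sidew (e j) by rewrite gtr_pMr.
  by congr f; rewrite mulrAC mulfV ?gt_eqF// mul1r; lra.
- move=> v /andP[v0 v1]; rewrite phi_rec /digit /digit_shift.
  have mv : midw (e j) * v < midw (e j) by rewrite gtr_pMr.
  have mv0 : 0 <= midw (e j) * v by rewrite mulr_ge0// ltW.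
  have -> : (sidew (e j) + midw (e j) * v < sidew (e j)) = false by lra.
  rewrite ltrD2l mv.
  have -> : (sidew (e j) + midw (e j) * v - sidew (e j)) / midw (e j) = v.
    by rewrite addrAC subrr add0r mulrAC mulfV ?gt_eqF// mul1r.
  by congr f; lra.
- move=> v /andP[v0 v1]; rewrite phi_rec /digit /digit_shift.
  have sv : sidew (e j) * v < sidew (e j) by rewrite gtr_pMr.
  have sv0 : 0 <= sidew (e j) * v by rewrite mulr_ge0// ltW.
  have -> : (sidew (e j) + midw (e j) + sidew (e j) * v < sidew (e j)) = false by lra.
  have -> : (sidew (e j) + midw (e j) + sidew (e j) * v < sidew (e j) + midw (e j)) =
    false by lra.
  have -> : (sidew (e j) + midw (e j) + sidew (e j) * v - sidew (e j) - midw (e j)) /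
      sidew (e j) = v by field; rewrite gt_eqF.
  by congr f; lra.
Qed.

End digits.

(** * Fourier coefficients of the digit expansion *)

Section trigonometry.
Variable R : realType.
Implicit Types x y s : R.

Lemma cos_lipschitz x y : `|cos x - cos y| <= `|x - y|.
Proof.
rewrite distrC [leRHS]distrC; wlog xy : x y / x <= y.
  move=> H; have [/H//|/ltW/H] := leP x y.
  by rewrite distrC [leRHS]distrC.
have [|c _ ->] := @MVT_segment R cos (fun z => - sin z) _ _ xy.
  by apply: continuous_subspaceT => z; exact: continuous_cos.
by rewrite normrM normrN ler_piMl// sin_max.
Qed.

(** The triple angle formula at pi makes [c] a root of 4c^3 - 3c + 1 = (c + 1)(2c - 1)^2, and [c] is
    positive. *)
Lemma cos_pithird : cos (pi / 3) = 1 / 2 :> R.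
Proof.
have p0 := @pi_gt0 R.
set c := cos (pi / 3).
have c0 : 0 < c by apply: cos_gt0_pihalf; apply/andP; split; lra.
have : cos (pi / 3 + (pi / 3 + pi / 3)) = - 1 :> R.
  by rewrite -cospi; congr cos; lra.
rewrite !cosD sinD -/c.
have s2 : sin (pi / 3) * sin (pi / 3) = 1 - c * c :> R.
  by rewrite -!expr2 sin2cos2.
have -> : c * (c * c - sin (pi / 3) * sin (pi / 3)) -
   sin (pi / 3) * (sin (pi / 3) * c + c * sin (pi / 3)) =
   c * (c * c) - 3 * c * (sin (pi / 3) * sin (pi / 3)) :> R by ring.
rewrite s2 => h.
have : (c + 1) * (2 * c - 1) ^+ 2 = 0.
  transitivity (c * (c * c) - 3 * c * (1 - c * c) + 1); first by ring.
  by rewrite h addNr.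
move/eqP; rewrite mulf_eq0 expf_eq0/= => /orP[/eqP|/eqP]; lra.
Qed.

Lemma cos_2pithird : 1 + 2 * cos (2 * pi / 3) = 0 :> R.
Proof.
have -> : 2 * pi / 3 = (pi / 3) *+ 2 :> R by rewrite mulr2n; lra.
by rewrite cos_mulr2n cos_pithird; lra.
Qed.

Lemma cos_ge_half x : `|x| <= pi / 3 -> 1 / 2 <= cos x.
Proof.
have p0 := @pi_gt0 R.
move=> xp; rewrite -cos_norm -cos_pithird leNgt ltr_cos ?in_itv/=.
- by rewrite -leNgt.
- by apply/andP; split; lra.
- by rewrite normr_ge0/=; lra.
Qed.

Lemma sin_ge_half x : pi / 6 <= x <= pi / 2 -> 1 / 2 <= sin x.
Proof.
move=> /andP[x1 x2]; rewrite -cosBpihalf; apply: cos_ge_half.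
by rewrite ler_norml; apply/andP; split; lra.
Qed.

Lemma sin_triple s : (1 + 2 * cos s) * sin (s / 2) = sin (3 * s / 2).
Proof.
set x := s / 2; have sx : s = x + x by rewrite /x; lra.
have h : cos x * cos x = 1 - sin x * sin x by rewrite -!expr2 cos2sin2.
have c2 : cos s = 1 - 2 * (sin x * sin x) by rewrite sx cosD h; lra.
have s2 : sin s = 2 * (sin x * cos x) by rewrite sx sinD; lra.
have -> : 3 * s / 2 = s + x by rewrite /x; lra.
rewrite sinD c2 s2.
have -> : 2 * (sin x * cos x) * cos x = 2 * sin x * (cos x * cos x) by ring.
by rewrite h; ring.
Qed.

Lemma cosD2pin x (n : nat) : cos (x + 2 * pi * n%:R) = cos x.
Proof.
have -> : x + 2 * pi * n%:R = x + pi *+ 2 *+ n.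
  by rewrite -[pi *+ 2 *+ n]mulr_natr -[pi *+ 2]mulr_natl.
exact: (periodicn (@cosD2pi R)).
Qed.

Lemma cos2pin (n : nat) : cos (2 * pi * n%:R) = 1 :> R.
Proof. by rewrite -[X in cos X]add0r cosD2pin cos0. Qed.

(** Modulus of the characteristic function of a digit uniform on -1, 0, 1. *)
Definition dirichlet3 s := `|1 + 2 * cos s| / 3.

Lemma dirichlet3_le1 s : dirichlet3 s <= 1.
Proof.
rewrite /dirichlet3 ler_pdivrMr// mul1r ler_norml.
by have := cos_geN1 s; have := cos_le1 s => *; apply/andP; split; lra.
Qed.

Lemma dirichlet3_ge0 s : 0 <= dirichlet3 s.
Proof. by rewrite divr_ge0. Qed.

(** [sin_triple] telescopes: the product of [K] three-point kernels at tripling frequencies is the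
    Dirichlet kernel of 3^K points. *)
Lemma prod_dirichlet3 s K :
  3 ^+ K * (\prod_(i < K) dirichlet3 (3 ^+ i * s)) * `|sin (s / 2)| =
    `|sin (3 ^+ K * s / 2)|.
Proof.
elim: K => [|K IH]; first by rewrite big_ord0 expr0 !mul1r.
rewrite big_ord_recr/= exprS.
transitivity (`|1 + 2 * cos (3 ^+ K * s)| *
    (3 ^+ K * (\prod_(i < K) dirichlet3 (3 ^+ i * s)) * `|sin (s / 2)|)).
  by rewrite /dirichlet3; field.
by rewrite IH -normrM sin_triple mulrA.
Qed.

End trigonometry.

(** * Characteristic functions of the expansions *)

Section fourier.
Variable R : realType.
Variable e : nat -> R.
Hypothesis e01 : forall j, 0 <= e j < 1.
Local Notation RR := (measurableTypeR R).
Local Notation phi := (phi e).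

Definition cos_coef (j : nat) (t : R) : R := \int[unif R]_u cos (t * phi j u).
Definition sin_coef (j : nat) (t : R) : R := \int[unif R]_u sin (t * phi j u).
(** Characteristic function of the digit of index [j], whose law is the mixture of the Dirac mass at
    0, with weight [e j], and of the uniform law on -1, 0, 1. *)
Definition symbol (j : nat) (s : R) := e j + (1 - e j) * (1 + 2 * cos s) / 3.

Lemma bdm_cos t : bdm (fun x : RR => cos (t * x)).
Proof.
split; last by exists 1 => x; exact: cos_max.
apply: measurableT_comp; last exact: measurable_funM.
by apply: continuous_measurable_fun; exact: continuous_cos.
Qed.

Lemma bdm_sin t : bdm (fun x : RR => sin (t * x)).
Proof.
split; last by exists 1 => x; exact: sin_max.
apply: measurableT_comp; last exact: measurable_funM.
by apply: continuous_measurable_fun; exact: continuous_sin.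
Qed.

Lemma bdm_phi (f : RR -> R) j : bdm f -> bdm (fun u : RR => f (phi j u)).
Proof. by apply: bdm_comp; exact: measurable_phi. Qed.

(** The sine terms produced by the digits 1 and -1 have equal weights and cancel. *)
Lemma cos_coef_rec j t : cos_coef j t = symbol j (t / 3) * cos_coef j.+1 (t / 3).
Proof.
rewrite /cos_coef (mean_phi_rec e01 j (bdm_cos t)).
set y := t / 3.
have bc := bdm_phi j.+1 (bdm_cos y); have bs := bdm_phi j.+1 (bdm_sin y).
have -> : \int[unif R]_u cos (t * ((phi j.+1 u - 1) / 3)) =
    cos y * cos_coef j.+1 y + sin y * sin_coef j.+1 y.
  rewrite -!meanZ// -meanD//; last 2 first.
  - by apply: bdmM => //; exact: bdm_cst.
  - by apply: bdmM => //; exact: bdm_cst.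
  apply: eq_Rintegral => u _.
  by rewrite (_ : t * _ = y * phi j.+1 u - y) ?cosB; [ring|rewrite /y; lra].
have -> : \int[unif R]_u cos (t * ((phi j.+1 u + 1) / 3)) =
    cos y * cos_coef j.+1 y - sin y * sin_coef j.+1 y.
  rewrite -!meanZ// -meanB//; last 2 first.
  - by apply: bdmM => //; exact: bdm_cst.
  - by apply: bdmM => //; exact: bdm_cst.
  apply: eq_Rintegral => u _.
  by rewrite (_ : t * _ = y * phi j.+1 u + y) ?cosD; [ring|rewrite /y; lra].
have -> : \int[unif R]_u cos (t * (phi j.+1 u / 3)) = cos_coef j.+1 y.
  by apply: eq_Rintegral => u _; rewrite (_ : t * _ = y * phi j.+1 u)// /y; lra.
by rewrite /symbol /sidew /midw /cos_coef /sin_coef; field.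
Qed.

Lemma sin_coef_rec j t : sin_coef j t = symbol j (t / 3) * sin_coef j.+1 (t / 3).
Proof.
rewrite /sin_coef (mean_phi_rec e01 j (bdm_sin t)).
set y := t / 3.
have bc := bdm_phi j.+1 (bdm_cos y); have bs := bdm_phi j.+1 (bdm_sin y).
have -> : \int[unif R]_u sin (t * ((phi j.+1 u - 1) / 3)) =
    cos y * sin_coef j.+1 y - sin y * cos_coef j.+1 y.
  rewrite -!meanZ// -meanB//; last 2 first.
  - by apply: bdmM => //; exact: bdm_cst.
  - by apply: bdmM => //; exact: bdm_cst.
  apply: eq_Rintegral => u _.
  by rewrite (_ : t * _ = y * phi j.+1 u - y) ?sinB; [ring|rewrite /y; lra].
have -> : \int[unif R]_u sin (t * ((phi j.+1 u + 1) / 3)) =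
    cos y * sin_coef j.+1 y + sin y * cos_coef j.+1 y.
  rewrite -!meanZ// -meanD//; last 2 first.
  - by apply: bdmM => //; exact: bdm_cst.
  - by apply: bdmM => //; exact: bdm_cst.
  apply: eq_Rintegral => u _.
  by rewrite (_ : t * _ = y * phi j.+1 u + y) ?sinD; [ring|rewrite /y; lra].
have -> : \int[unif R]_u sin (t * (phi j.+1 u / 3)) = sin_coef j.+1 y.
  by apply: eq_Rintegral => u _; rewrite (_ : t * _ = y * phi j.+1 u)// /y; lra.
by rewrite /symbol /sidew /midw /cos_coef /sin_coef; field.
Qed.

Lemma symbol_le j s : `|symbol j s| <= e j + dirichlet3 s.
Proof.
have /andP[e0 e1] := e01 j.
rewrite /symbol (le_trans (ler_normD _ _))// (ger0_norm e0) lerD2l.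
rewrite !normrM normfV [`|3|]ger0_norm// [`|1 - e j|]ger0_norm; last by lra.
by rewrite -mulrA -/(dirichlet3 s) ler_piMl ?dirichlet3_ge0//; lra.
Qed.

Lemma symbol_le1 j s : `|symbol j s| <= 1.
Proof.
have /andP[e0 e1] := e01 j.
have h1 := cos_geN1 s; have h2 := cos_le1 s.
by rewrite /symbol ler_norml; apply/andP; split; nra.
Qed.

Lemma cos_coef_le1 j t : `|cos_coef j t| <= 1.
Proof.
apply: mean_normr_le => [|u]; last exact: cos_max.
exact: (bdm_phi j (bdm_cos t)).
Qed.

Lemma cos_coef0 j : cos_coef j 0 = 1.
Proof.
rewrite /cos_coef -[RHS](mean_cst (unif R) 1).
by apply: eq_Rintegral => u _; rewrite mul0r cos0.
Qed.

Lemma cos_coef_lipschitz j t t' : `|cos_coef j t - cos_coef j t'| <= `|t - t'| / 2.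
Proof.
rewrite /cos_coef -meanB; [|exact: (bdm_phi j (bdm_cos _))..].
apply: mean_normr_le => [|u].
  by apply: bdmB; exact: (bdm_phi j (bdm_cos _)).
rewrite (le_trans (cos_lipschitz _ _))// -mulrBl normrM.
by rewrite ler_wpM2l// (le_trans (phi_bound e _ _))//; lra.
Qed.

Lemma cos_coef_near1 j t : `|1 - cos_coef j t| <= `|t| / 2.
Proof. by have := cos_coef_lipschitz j 0 t; rewrite cos_coef0 sub0r normrN. Qed.

Lemma sin_coef_le j t : `|sin_coef j t| <= `|t|.
Proof.
apply: mean_normr_le => [|u]; first exact: (bdm_phi j (bdm_sin _)).
have -> : sin (t * phi j u) = cos (t * phi j u - pi / 2) - cos (- (pi / 2)).
  by rewrite cosBpihalf cosN cos_pihalf subr0.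
rewrite (le_trans (cos_lipschitz _ _))// opprK subrK normrM.
by rewrite ler_piMr// (le_trans (phi_bound e _ _))//; lra.
Qed.

(** Each step of the recursion divides the frequency by 3 and multiplies by a symbol of modulus at
    most 1, while a sine coefficient is at most its frequency. *)
Lemma sin_coef_eq0 j t : sin_coef j t = 0.
Proof.
have h n : `|sin_coef j t| <= `|t| * (1 / 3) ^+ n.
  elim: n j t => [|n IH] j t; first by rewrite mulr1 sin_coef_le.
  rewrite sin_coef_rec normrM (le_trans (ler_piMl _ (symbol_le1 _ _)))//.
  rewrite (le_trans (IH _ _))// normrM exprS mulrA mul1r.
  by rewrite normfV [`|3|]ger0_norm.
apply/eqP; rewrite -normr_le0.
have : `|t| * (1 / 3) ^+ n @[n --> \oo] --> `|t| * 0.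
  by apply: cvgM; [exact: cvg_cst | apply: cvg_expr; rewrite ger0_norm//; lra].
rewrite mulr0 => tc.
rewrite -(cvg_lim _ tc)//; apply: limr_ge; first exact: cvgP tc.
exact: nearW.
Qed.

(** The first [d] digits contribute integers to 3^d times the expansion, so the character does not
    see them: every symbol crossed is taken at a multiple of 2 pi and equals 1. *)
Lemma cos_coef_pow3 j d (n : nat) :
  cos_coef j (2 * pi * (3 ^+ d * n%:R)) = cos_coef (j + d)%N (2 * pi * n%:R).
Proof.
elim: d j => [|d IH] j; first by rewrite addn0 expr0 mul1r.
rewrite cos_coef_rec (_ : _ / 3 = 2 * pi * (3 ^+ d * n%:R)); last by rewrite exprS; field.
have E : 3 ^+ d * n%:R = (3 ^ d * n)%N%:R :> R by rewrite natrM natrX.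
rewrite IH addSnnS /symbol E cos2pin (_ : e j + _ = 1) ?mul1r//.
by lra.
Qed.

(** Removing a digit divides [x] by 3 and produces the same symbol in both terms, 2 pi 3^d being a
    period. After [d] digits the perturbation is x / 3^d, and two Lipschitz estimates with constant
    1/2 conclude. *)
Lemma cos_coef_decouple d j x :
  `|cos_coef j (2 * pi * 3 ^+ d + x) - cos_coef (j + d)%N (2 * pi) * cos_coef j x|
    <= `|x| / 3 ^+ d.
Proof.
elim: d j x => [|d IH] j x.
  rewrite addn0 expr0 mulr1 divr1.
  have -> : cos_coef j (2 * pi + x) - cos_coef j (2 * pi) * cos_coef j x =
    (cos_coef j (2 * pi + x) - cos_coef j (2 * pi)) +
    cos_coef j (2 * pi) * (1 - cos_coef j x) by ring.
  rewrite (le_trans (ler_normD _ _))// [leRHS](splitr `|x|) lerD//.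
    by rewrite (le_trans (cos_coef_lipschitz _ _ _))// addrAC subrr add0r.
  rewrite normrM (le_trans _ (cos_coef_near1 j x))//.
  by rewrite ler_piMl// cos_coef_le1.
rewrite !(cos_coef_rec j) -addSnnS.
have -> : (2 * pi * 3 ^+ d.+1 + x) / 3 = 2 * pi * 3 ^+ d + x / 3 by rewrite exprS; field.
have -> : symbol j (2 * pi * 3 ^+ d + x / 3) = symbol j (x / 3).
  by rewrite /symbol [_ + x / 3]addrC -natrX cosD2pin.
rewrite mulrCA -mulrBr normrM (le_trans (ler_piMl _ (symbol_le1 _ _)))//.
rewrite (le_trans (IH _ _))// exprS invfM mulrA normrM.
by rewrite normfV [`|3|]ger0_norm.
Qed.

(** At 2 pi / 3 the uniform part of the symbol vanishes, leaving exactly [e m]; the remaining phase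
    is at most pi / 3, where the cosine is at least 1/2. *)
Lemma cos_coef_ge m : e m / 2 <= cos_coef m (2 * pi).
Proof.
have /andP[e0 e1] := e01 m.
rewrite cos_coef_rec /symbol cos_2pithird mulr0 mul0r addr0 ler_wpM2l//.
rewrite -div1r -[leLHS](mean_cst (unif R)); apply: mean_le.
- exact: bdm_cst.
- exact: (bdm_phi m.+1 (bdm_cos _)).
move=> u; apply: cos_ge_half; rewrite normrM.
have p0 := @pi_gt0 R.
rewrite ger0_norm; last by lra.
by have := phi_bound e m.+1 u => h; nra.
Qed.

(** Each symbol is at most [e] + [dirichlet3]. As all factors are at most 1, expanding the product
    costs each bias only once, additively. *)
Lemma cos_coef_window K j s : `|cos_coef j (3 ^+ K * s)| <=
  \prod_(i < K) dirichlet3 (3 ^+ i * s) + \sum_(i < K) e (j + i)%N.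
Proof.
elim: K j => [|K IH] j; first by rewrite !big_ord0 addr0 cos_coef_le1.
rewrite cos_coef_rec (_ : _ / 3 = 3 ^+ K * s); last by rewrite exprS; field.
rewrite normrM big_ord_recr big_ord_recl/= addn0.
under [X in _ + (_ + X)]eq_bigr do rewrite /bump/= addnCA add1n -addSn.
have /andP[e0 e1] := e01 j.
have := IH j.+1; have := symbol_le j (3 ^+ K * s); have := cos_coef_le1 j.+1 (3 ^+ K * s).
have := dirichlet3_le1 (3 ^+ K * s); have := dirichlet3_ge0 (3 ^+ K * s).
set c := `|cos_coef _ _|; set D := dirichlet3 _; set q := `|symbol _ _|.
set P := \prod_(i < K) _; set S := \sum_(i < K) _ => D0 D1 c1 qD cPS.
have c0 : 0 <= c by exact: normr_ge0.
have P0 : 0 <= P by apply: prodr_ge0 => i _; exact: dirichlet3_ge0.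
have S0 : 0 <= S by apply: sumr_ge0 => i _; have /andP[] := e01 (j.+1 + i).
apply: (@le_trans _ _ ((e j + D) * c)); first exact: ler_wpM2r.
by rewrite mulrDl; nra.
Qed.

End fourier.

(** * The circle *)

Section circle_integrals.
Variable R : realType.
Local Notation RR := (measurableTypeR R).
Local Notation T := (circle R).
Local Notation mu := (@lebesgue_measure R).
Local Notation wrap := (@Defs.wrap R).
Local Notation conv := (@Defs.conv R).

Definition periodic1 (U : Type) (h : R -> U) :=
  forall (k : int) u, h (u + k%:~R) = h u.

(** Periodicity reduces to 0 <= t < 1; then [t, t + 1] is cut at 1 and its part beyond 1 moved back
    onto [0, t]. *)
Lemma unif_translate (h : R -> \bar R) t : measurable_fun setT h ->
  (forall x, 0 <= h x)%E -> periodic1 h ->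
  (\int[unif R]_u h (t + u)%R = \int[unif R]_u h u)%E.
Proof.
move=> mh h0 ph.
wlog : t / 0 <= t < 1.
  move=> H; rewrite -(H (t - (Num.floor t)%:~R)); last first.
    have /andP[t1 t2] := mem_rg1_floor t.
    by rewrite subr_ge0 t1 ltrBlDr addrC.
  by apply: eq_integral => u _; rewrite addrAC -intrN ph.
move=> /andP[t0 t1].
have mhp (a p : R) : measurable_fun setT (fun v : RR => h (a + p * v)).
  exact: (measurableT_comp mh (@measurable_affine R a p)).
have E (a p : R) : 0 < p -> (p%:E * \int[unif R]_v h (a + p * v)%R =
    \int[mu]_(x in `[a, (a + p)%R]) h x)%E.
  move=> p0; rewrite integral_unif; [|exact: mhp|by move=> *; exact: h0].
  exact: (esym (ge0_integral_affine a p0 mh h0)).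
have [->|tn0] := eqVneq t 0.
  by apply: eq_integral => u _; rewrite add0r.
have t0' : 0 < t by rewrite lt_neqAle eq_sym tn0.
have := E t 1 ltr01; rewrite mul1e.
under eq_integral do rewrite mul1r.
move=> ->; rewrite (ge0_integral_itvU (b := 1))//; [|exact: ltW|by lra].
have -> : (\int[mu]_(x in `[1%R, (t + 1)%R]) h x = \int[mu]_(x in `[0%R, t]) h x)%E.
  rewrite [t + 1]addrC -{2}[t]add0r -(E 1 t)// -(E 0 t)//; congr (_ * _)%E.
  by apply: eq_integral => u _; rewrite addrC (ph 1%Z) add0r.
rewrite addeC -ge0_integral_itvU//; last exact: ltW.
by rewrite integral_unif.
Qed.

Definition angle (u : R) : T := wrap (2 * pi * u).

Lemma measurable_angle : measurable_fun setT (angle : RR -> T).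
Proof. by apply: (measurableT_comp (@measurable_wrap R)); exact: measurable_funM. Qed.

HB.instance Definition _ :=
  isMeasurableFun.Build _ _ _ _ (angle : RR -> T) measurable_angle.

Lemma angle_periodic : periodic1 angle.
Proof.
move=> k u; apply/esym/(@wrap_eq R _ _ k).
by rewrite -mulr_natl; ring.
Qed.

Lemma angleD u v : angle (u + v) = angle u + angle v.
Proof.
apply/esym; apply: (@wrap_eq _ _ _ (turns (2 * pi * u) + turns (2 * pi * v))).
by rewrite /= intrD -mulr_natl; ring.
Qed.

Lemma angleN u : angle (- u) = - angle u.
Proof.
apply/esym; apply: (@wrap_eq _ _ _ (- turns (2 * pi * u))).
by rewrite /= intrN -mulr_natl; ring.
Qed.

Lemma angleB u v : angle (u - v) = angle u - angle v.
Proof. by rewrite angleD angleN. Qed.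

Lemma integral_haar (F : T -> \bar R) : measurable_fun setT F ->
  (forall x, 0 <= F x)%E ->
  (\int[haar R]_x F x = \int[unif R]_u F (angle u))%E.
Proof.
move=> mF F0; rewrite ge0_integral_distribution//.
have p0 := @pi_gt0 R.
have mFw : measurable_fun setT (F \o wrap : RR -> \bar R).
  exact: (measurableT_comp mF (@measurable_wrap R)).
have A : (\int[mu]_(x in `[(- pi)%R, (pi : R)]) (F \o wrap) x =
    (pi + pi)%:E * \int[mu]_(v in `[0%R, 1%R]) 
      (F \o wrap) (- pi + (pi + pi) * v)%R)%E.
  have := @ge0_integral_affine R (- pi) (pi + pi) (F \o wrap).
  have -> : - pi + (pi + pi) = pi :> R by lra.
  by apply => //; [lra | move=> x; exact: F0].
transitivity ((pi - - pi)^-1%:E *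
    \int[mu]_(x in `[(- pi)%R, (pi : R)]) (F \o wrap) x)%E.
  by rewrite integral_uniform// => x; exact: F0.
rewrite {}A opprK.
rewrite muleA -EFinM mulVf ?mul1e; last by rewrite gt_eqF//; lra.
rewrite -integral_unif//; last 2 first.
- exact: (measurableT_comp mFw (@measurable_affine R (- pi) (pi + pi))).
- by move=> x; exact: F0.
have mFa : measurable_fun setT (F \o angle : RR -> \bar R).
  exact: (measurableT_comp mF measurable_angle).
have pFa : periodic1 (F \o angle) by move=> k u /=; rewrite angle_periodic.
(* Rescaling [-pi, pi] to [0, 1] leaves a rotation by half a turn, absorbed by invariance. *)
have := @unif_translate (F \o angle) (- (1 / 2)) mFa (fun x => F0 _) pFa.
move=> <-; apply: eq_integral => u _ /=; congr (F (wrap _)).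
by field.
Qed.

Lemma mean_haar (F : T -> R) : bdm F ->
  \int[haar R]_x F x = \int[unif R]_u F (angle u).
Proof.
move=> bF; have [mF [M FM]] := bF.
have bFa : bdm (fun u : RR => F (angle u)).
  by apply: bdm_comp bF; exact: measurable_angle.
apply: (addIr M).
rewrite -{1}(mean_cst (haar R) M) -{2}(mean_cst (unif R) M).
rewrite -!meanD//; try exact: bdm_cst.
congr fine; rewrite (integral_haar (F := fun x => (F x + M)%:E))//.
  by apply/measurable_EFinP; apply: measurable_funD.
by move=> x; rewrite lee_fin; have := FM x; rewrite ler_norml => /andP[? _]; lra.
Qed.

Lemma cos_cval_wrap (n : int) y : cos (n%:~R * cval (wrap y)) = cos (n%:~R * y).
Proof.
have E : n%:~R * cval (wrap y) = n%:~R * y + (- (n * turns y))%:~R * (pi *+ 2).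
  by rewrite /= intrN intrM; ring.
rewrite {}E; case: (- _)%R => k.
  by rewrite pmulrn [_%:R * _]mulr_natl (periodicn (@cosD2pi R)).
rewrite NegzE intrN mulNr -[in LHS](periodicn (@cosD2pi R) k.+1).
by rewrite -[pi *+ 2 *+ k.+1]mulr_natl [k.+1%:~R](_ : _ = k.+1%:R)// subrK.
Qed.

Lemma sin_cval_wrap (n : int) y : sin (n%:~R * cval (wrap y)) = sin (n%:~R * y).
Proof.
have E : n%:~R * cval (wrap y) = n%:~R * y + (- (n * turns y))%:~R * (pi *+ 2).
  by rewrite /= intrN intrM; ring.
rewrite {}E; case: (- _)%R => k.
  by rewrite pmulrn [_%:R * _]mulr_natl (periodicn (@sinD2pi R)).
rewrite NegzE intrN mulNr -[in LHS](periodicn (@sinD2pi R) k.+1).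
by rewrite -[pi *+ 2 *+ k.+1]mulr_natl [k.+1%:~R](_ : _ = k.+1%:R)// subrK.
Qed.

Lemma bdm_cos_cval (n : int) : bdm (fun x : T => cos (n%:~R * cval x)).
Proof. exact: (bdm_comp (@measurable_cval R) (bdm_cos n%:~R)). Qed.

Lemma bdm_sin_cval (n : int) : bdm (fun x : T => sin (n%:~R * cval x)).
Proof. exact: (bdm_comp (@measurable_cval R) (bdm_sin n%:~R)). Qed.

Lemma mean_conv (nu rho : probability T R) (F : T -> R) : bdm F ->
  \int[conv nu rho]_x F x = \int[nu]_x \int[rho]_y F (x + y).
Proof.
move=> bF; rewrite mean_distribution//.
rewrite (@mean_prod _ _ _ _ _ nu rho (fun z => F (circle_add z)))//.
by apply: bdm_comp bF; exact: measurable_circle_add.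
Qed.

(** Real Fourier coefficients: with vanishing sine parts, convolution multiplies real sequences and
    no complex arithmetic is needed. *)
Definition has_cos_coefs (nu : probability T R) (c : int -> R) :=
  forall n : int, \int[nu]_x cos (n%:~R * cval x) = c n /\
    \int[nu]_x sin (n%:~R * cval x) = 0.

Lemma conv_cos_coefs nu rho c d : has_cos_coefs nu c -> has_cos_coefs rho d ->
  has_cos_coefs (conv nu rho) (fun n => c n * d n).
Proof.
move=> hc hd n; have [c1 s1] := hc n; have [c2 s2] := hd n.
have bc := bdm_cos_cval n; have bs := bdm_sin_cval n.
rewrite !mean_conv//; split.
- under eq_Rintegral => x _.
    under eq_Rintegral do rewrite cos_cval_wrap mulrDr cosD.
    rewrite meanB ?meanZ ?c2 ?s2 ?mulr0 ?subr0//; last 2 first.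
    + by apply: bdmM => //; exact: bdm_cst.
    + by apply: bdmM => //; exact: bdm_cst.
    rewrite mulrC; over.
  by rewrite meanZ// c1 mulrC.
- under eq_Rintegral => x _.
    under eq_Rintegral do rewrite sin_cval_wrap mulrDr sinD.
    rewrite meanD ?meanZ ?c2 ?s2 ?mulr0 ?addr0//; last 2 first.
    + by apply: bdmM => //; exact: bdm_cst.
    + by apply: bdmM => //; exact: bdm_cst.
    rewrite mulrC; over.
  by rewrite meanZ// s1 mulr0.
Qed.

Lemma dirac_cos_coefs : has_cos_coefs (\d_(0 : T) : probability T R) (fun=> 1).
Proof.
have E n (f : R -> R) : measurable_fun setT f ->
    \int[(\d_(0 : T) : probability T R)]_x f (n%:~R * cval x) =
    f (n%:~R * cval (0 : T)).
  move=> mf; rewrite /Rintegral integral_dirac//.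
    by rewrite diracT mul1e.
  apply/measurable_EFinP; apply: (measurableT_comp mf).
  by apply: measurable_funM => //; exact: measurable_cval.
have mc : measurable_fun setT (@cos R).
  by apply: continuous_measurable_fun; exact: continuous_cos.
have ms : measurable_fun setT (@sin R).
  by apply: continuous_measurable_fun; exact: continuous_sin.
move=> n; rewrite !E// cos_cval_wrap sin_cval_wrap mulr0 cos0 sin0; split => //.
Qed.

Lemma convpow_cos_coefs nu c k : has_cos_coefs nu c ->
  has_cos_coefs (convpow nu k) (fun n => c n ^+ k).
Proof.
move=> hc; elim: k => [|k IH] n; first exact: dirac_cos_coefs.
by rewrite exprS; exact: (conv_cos_coefs hc IH).
Qed.

End circle_integrals.

(** * Singularity from lacunary Fourier coefficients *)

Section singularity.
Variable R : realType.
Local Notation RR := (measurableTypeR R).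
Local Notation T := (circle R).
Local Notation haar := (@Defs.haar R).

Lemma mean_chebyshev d (X : measurableType d) (P : probability X R) (A : set X)
    (g : X -> R) : measurable A -> bdm g -> (forall x, A x -> 1 / 2 <= `|g x|) ->
  (P A <= (4 * \int[P]_x g x ^+ 2)%:E)%E.
Proof.
move=> mA bg Ag.
have bA : bdm (\1_A : X -> R).
  split; first exact: measurable_indic.
  by exists 1 => x; rewrite indicE; case: (_ \in _); rewrite ?normr1 ?normr0.
have -> : (P A = (\int[P]_x (\1_A x : R))%:E)%E.
  by rewrite mean_EFin// integral_indic// setIT.
have bg2 := bdmX 2 bg.
rewrite lee_fin -meanZ//; apply: mean_le => //.
  by apply: bdmM => //; exact: bdm_cst.
move=> x; rewrite indicE; case: (boolP (x \in A)) => [|_].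
  rewrite inE => /Ag h; rewrite -(real_normK (num_real (g x))) /=; nra.
by rewrite mulr_ge0// sqr_ge0.
Qed.

(** By Borel-Cantelli the limsup of the [A j] is null for [Q]. A point outside it lies in all but
    finitely many of the complements, hence in their limsup, which is null for [P]. *)
Lemma singular_measures_of_sets d (X : measurableType d) (P Q : probability X R)
    (A : (set X)^nat) : (forall j, measurable (A j)) ->
  (forall j, (P (~` A j) <= (1 / 2 ^+ j)%:E)%E) ->
  (forall j, (Q (A j) <= (1 / 2 ^+ j)%:E)%E) ->
  singular_measures P Q.
Proof.
move=> mA PA QA.
have fin (m : {measure set X -> \bar R}) (F : (set X)^nat) :
    (forall j, (m (F j) <= (1 / 2 ^+ j)%:E)%E) -> (\sum_(j <oo) m (F j) < +oo)%E.
  move=> mF; apply: (@le_lt_trans _ _ 2%:E); last exact: ltry.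
  apply: (le_trans _ (epsilon_trick0 xpredT (ler0n _ 2))).
  apply: lee_nneseries => // j _; rewrite (le_trans (mF j))// lee_fin.
  by rewrite expnS natrM natrX invfM mulrA mulfV.
exists (~` lim_sup_set A); split.
- apply: measurableC; apply: bigcap_measurable => // n _.
  by apply: bigcup_measurable => j _; exact: mA.
- apply/eqP; rewrite eq_le measure_ge0 andbT.
  rewrite -(@lim_sup_set_cvg0 _ _ _ P (fun j => ~` A j)); last 2 first.
  + by move=> j; exact: measurableC.
  + exact: fin.
  apply: le_measure; rewrite ?inE.
  + apply: measurableC; apply: bigcap_measurable => // n _.
    by apply: bigcup_measurable => j _; exact: mA.
  + apply: bigcap_measurable => // n _.
    by apply: bigcup_measurable => j _; exact/measurableC/mA.
  move=> x xA n _; apply: contrapT => h; apply: xA => k _.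
  exists (maxn n k); first exact: leq_maxr.
  apply: contrapT => h'; apply: h; exists (maxn n k) => //.
  exact: leq_maxl.
- by rewrite setCK; apply: lim_sup_set_cvg0 => //; exact: fin.
Qed.

Lemma sum_pow3_le N : \sum_(l < N) (1 / 3 ^+ (N - l)%N : R) <= 1 / 2.
Proof.
elim: N => [|N IH]; first by rewrite big_ord0; lra.
rewrite big_ord_recr/= subSnn expr1.
have -> : \sum_(l < N) (1 / 3 ^+ (N.+1 - l)%N : R) =
    (\sum_(l < N) (1 / 3 ^+ (N - l)%N)) / 3.
  rewrite mulr_suml; apply: eq_bigr => l _.
  by rewrite subSn ?(ltnW (ltn_ord l))// exprS invfM !mul1r mulrC.
by lra.
Qed.

(** * Variance of lacunary cosine sums *)

Section variance.
Variables (P : probability T R) (c : int -> R) (B : R).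
Hypothesis hc : has_cos_coefs P c.
Hypothesis c1 : forall n, `|c n| <= 1.
Hypothesis hB : forall l d, (0 < d)%N -> forall s : bool,
  `|c ((3 ^ (l + d))%N%:Z + (-1) ^+ s * (3 ^ l)%N%:Z) -
    c (3 ^ (l + d))%N%:Z * c (3 ^ l)%N%:Z| <= B / 3 ^+ d.

Let cosm m (x : T) := cos ((3 ^ m)%N%:Z%:~R * cval x).

Definition lacunary_sum N (x : T) : R :=
  \sum_(m < N) cos ((3 ^ m)%N%:Z%:~R * cval x).

Definition lacunary_mean N : R := \sum_(m < N) c (3 ^ m)%N%:Z.

Lemma bdm_lacunary_sum N : bdm (lacunary_sum N).
Proof. by apply: bdm_sum => m; exact: bdm_cos_cval. Qed.

Let Y m (x : T) := cosm m x - c (3 ^ m)%N%:Z.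

Let bY m : bdm (Y m).
Proof. by apply: bdmB; [exact: bdm_cos_cval | exact: bdm_cst]. Qed.

(** The product of two cosines is half the sum of the cosines at 3^(l+d) + 3^l and 3^(l+d) - 3^l,
    whence the two signs in [hB]: both coefficients are close to the product of the means. *)
Let covariance_le l d : (0 < d)%N ->
  `|\int[P]_x (Y l x * Y (l + d)%N x)| <= B / 3 ^+ d.
Proof.
move=> d0; set a := c (3 ^ l)%N%:Z; set b := c (3 ^ (l + d))%N%:Z.
set p := (3 ^ (l + d))%N%:Z + (3 ^ l)%N%:Z.
set q := (3 ^ (l + d))%N%:Z - (3 ^ l)%N%:Z.
have h1 : `|c p - b * a| <= B / 3 ^+ d.
  by have := hB l d0 false; rewrite expr0 mul1r.
have h2 : `|c q - b * a| <= B / 3 ^+ d.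
  by have := hB l d0 true; rewrite expr1 mulN1r.
have E x : Y l x * Y (l + d)%N x =
    (1 / 2 * cos (p%:~R * cval x) + 1 / 2 * cos (q%:~R * cval x)) -
    (a * cosm (l + d) x + b * cosm l x) + a * b.
  have -> : cos (p%:~R * cval x) = cosm (l + d) x * cosm l x -
      sin ((3 ^ (l + d))%N%:Z%:~R * cval x) * sin ((3 ^ l)%N%:Z%:~R * cval x).
    by rewrite /p intrD mulrDl cosD.
  have -> : cos (q%:~R * cval x) = cosm (l + d) x * cosm l x +
      sin ((3 ^ (l + d))%N%:Z%:~R * cval x) * sin ((3 ^ l)%N%:Z%:~R * cval x).
    by rewrite /q intrB mulrBl cosB.
  by rewrite /Y -/a -/b; field.
have bc n := bdm_cos_cval R n.
have bZ n (r : R) : bdm (fun x : T => r * cos (n%:~R * cval x)).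
  by apply: bdmM => //; exact: bdm_cst.
have -> : \int[P]_x (Y l x * Y (l + d)%N x) =
    1 / 2 * (c p - b * a) + 1 / 2 * (c q - b * a).
  under eq_Rintegral do rewrite E.
  have bD n m (r s : R) :
      bdm (fun x : T => r * cos (n%:~R * cval x) + s * cos (m%:~R * cval x)).
    exact: bdmD.
  have bm m : bdm (cosm m) by exact: bc.
  have bmZ m (r : R) : bdm (fun x => r * cosm m x) by exact: bZ.
  have bmD : bdm (fun x => a * cosm (l + d) x + b * cosm l x) by exact: bdmD.
  rewrite meanD; [|by apply: bdmB => //; exact: bD|exact: bdm_cst].
  rewrite mean_cst meanB// meanD// meanD// !meanZ//.
  by rewrite /cosm !(hc _).1 -/a -/b; field.
rewrite -mulrDr normrM [`|1 / 2|]ger0_norm; last by lra.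
by have := ler_normD (c p - b * a) (c q - b * a); lra.
Qed.

(** Each new term brings its own variance, at most 4, and twice its covariances with the earlier
    ones, whose sum is at most [|B|] / 2 by the geometric series. *)
Lemma variance_le N :
  \int[P]_x ((lacunary_sum N x - lacunary_mean N) ^+ 2) <= (`|B| + 4) * N%:R.
Proof.
have bX n : bdm (fun x => lacunary_sum n x - lacunary_mean n).
  by apply: bdmB; [exact: bdm_lacunary_sum | exact: bdm_cst].
elim: N => [|N IH].
  under eq_Rintegral do rewrite /lacunary_sum /lacunary_mean !big_ord0 subr0 expr0n/=.
  by rewrite mean_cst mulr0.
have E x : (lacunary_sum N.+1 x - lacunary_mean N.+1) ^+ 2 =
    (lacunary_sum N x - lacunary_mean N) ^+ 2 +
    (2 * \sum_(l < N) (Y l x * Y N x) + Y N x ^+ 2).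
  rewrite -mulr_suml /Y sumrB -/(lacunary_mean N) -/(lacunary_sum N x).
  rewrite [lacunary_sum N.+1 x]big_ord_recr [lacunary_mean N.+1]big_ord_recr/=.
  by rewrite -/(lacunary_mean N) -/(lacunary_sum N x) /cosm; ring.
under eq_Rintegral do rewrite E.
have bYY l m : bdm (fun x => Y l x * Y m x) by exact: bdmM.
have bS : bdm (fun x => \sum_(l < N) (Y l x * Y N x)) by exact: bdm_sum.
have bY2 := bdmX 2 (bY N).
have b2S : bdm (fun x => 2 * \sum_(l < N) (Y l x * Y N x)).
  by apply: bdmM => //; exact: bdm_cst.
rewrite meanD; [|exact: bdmX|exact: bdmD].
rewrite meanD// meanZ// mean_sum//.
have Y2 : \int[P]_x (Y N x ^+ 2) <= 4.
  rewrite (le_trans (ler_norm _))// mean_normr_le// => x.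
  have := cos_le1 ((3 ^ N)%N%:Z%:~R * cval x).
  have := cos_geN1 ((3 ^ N)%N%:Z%:~R * cval x).
  have := c1 (3 ^ N)%N%:Z; rewrite ler_norml => /andP[u1 u2] v1 v2.
  rewrite ger0_norm ?sqr_ge0// /Y /cosm; nra.
have S1 : \sum_(l < N) \int[P]_x (Y l x * Y N x) <= `|B| * (1 / 2).
  apply: (@le_trans _ _ (\sum_(l < N) (`|B| * (1 / 3 ^+ (N - l)%N)))).
    apply: ler_sum => l _; have lN := ltn_ord l.
    have := @covariance_le l (N - l)%N; rewrite subn_gt0 (subnKC (ltnW lN)).
    move=> /(_ lN) h; rewrite (le_trans (ler_norm _))// (le_trans h)//.
    by rewrite mul1r ler_wpM2r ?invr_ge0 ?exprn_ge0// ler_norm.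
  by rewrite -mulr_sumr ler_wpM2l// sum_pow3_le.
rewrite -[N.+1%:R]natr1 mulrDr mulr1 lerD//; lra.
Qed.

End variance.

Lemma mean_translate (h : RR -> R) t : bdm h -> periodic1 h ->
  \int[unif R]_u h (t + u) = \int[unif R]_u h u.
Proof.
move=> bh ph; have [mh [M hM]] := bh.
have bt : bdm (fun u : RR => h (t + u)).
  by have := bdm_affine t 1 bh; under [X in bdm X -> _]funext do rewrite mul1r.
apply: (addIr M); rewrite -{1 2}(mean_cst (unif R) M) -!meanD//; try exact: bdm_cst.
congr fine; apply: (@unif_translate R (fun x => (h x + M)%:E)).
- by apply/measurable_EFinP; apply: measurable_funD.
- by move=> x; rewrite lee_fin; have := hM x; rewrite ler_norml => /andP[? _]; lra.
- by move=> k u; rewrite ph.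
Qed.

Lemma haar_cos_coefs : has_cos_coefs haar (fun n => (n == 0)%:R).
Proof.
move=> n.
have bc : bdm (fun u : RR => cos (n%:~R * (2 * pi * u))).
  under [X in bdm X]funext do rewrite mulrA; exact: bdm_cos.
have bs : bdm (fun u : RR => sin (n%:~R * (2 * pi * u))).
  under [X in bdm X]funext do rewrite mulrA; exact: bdm_sin.
have ec u : cos (n%:~R * cval (angle u)) = cos (n%:~R * (2 * pi * u)) :> R.
  exact: cos_cval_wrap.
have es u : sin (n%:~R * cval (angle u)) = sin (n%:~R * (2 * pi * u)) :> R.
  exact: sin_cval_wrap.
have pc : periodic1 (fun u => cos (n%:~R * (2 * pi * u)) : R).
  by move=> k u; rewrite -!ec angle_periodic.
have ps : periodic1 (fun u => sin (n%:~R * (2 * pi * u)) : R).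
  by move=> k u; rewrite -!es angle_periodic.
rewrite !mean_haar; [|exact: bdm_sin_cval|exact: bdm_cos_cval].
under eq_Rintegral do rewrite ec.
under [X in _ /\ X = _]eq_Rintegral do rewrite es.
have [->|n0] := eqVneq n 0.
  by split; under eq_Rintegral do rewrite mul0r ?cos0 ?sin0; rewrite mean_cst.
(* Translating by half a period changes the sign of the character, so its integral equals its
   opposite. *)
have E u : n%:~R * (2 * pi * (1 / (2 * n%:~R) + u)) = n%:~R * (2 * pi * u) + pi :> R.
  by field; rewrite intr_eq0.
split.
- have := mean_translate (1 / (2 * n%:~R)) bc pc.
  under eq_Rintegral do rewrite E cosDpi -mulN1r.
  by rewrite meanZ//= => h; lra.
- have := mean_translate (1 / (2 * n%:~R)) bs ps.
  under eq_Rintegral do rewrite E sinDpi -mulN1r.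
  by rewrite meanZ//= => h; lra.
Qed.

(** The normalized sum [g j] has mean 1 under [P] and 0 under Haar measure, with small variance
    under both; the level 1/2 separates them. *)
Lemma singular_of_cos_coefs (P : probability T R) (c : int -> R) (B : R) :
  has_cos_coefs P c -> (forall n, `|c n| <= 1) ->
  (forall l d, (0 < d)%N -> forall s : bool,
    `|c ((3 ^ (l + d))%N%:Z + (-1) ^+ s * (3 ^ l)%N%:Z) -
      c (3 ^ (l + d))%N%:Z * c (3 ^ l)%N%:Z| <= B / 3 ^+ d) ->
  (forall K : R, exists N,
    0 < lacunary_mean c N /\ K * N%:R <= lacunary_mean c N ^+ 2) ->
  singular P.
Proof.
move=> hc c1 hB hN.
(* [|B| + 4] is the variance constant, 4 comes from Chebyshev at level 1/2, and 2^j makes the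
   exceptional measures summable. *)
have {}hN j : exists N, 0 < lacunary_mean c N /\
   (4 * (`|B| + 4) * 2 ^+ j) * N%:R <= lacunary_mean c N ^+ 2 by exact: hN.
pose N j := projT1 (cid (hN j)).
have M0 j : 0 < lacunary_mean c (N j) := (projT2 (cid (hN j))).1.
have MN j : (4 * (`|B| + 4) * 2 ^+ j) * (N j)%:R <= lacunary_mean c (N j) ^+ 2 :=
  (projT2 (cid (hN j))).2.
pose g j x := lacunary_sum (N j) x / lacunary_mean c (N j).
have bg j : bdm (g j) by apply: bdmM; [exact: bdm_lacunary_sum | exact: bdm_cst].
have bg1 j : bdm (fun x => g j x - 1) by apply: bdmB => //; exact: bdm_cst.
have mA j : measurable [set x | 1 / 2 <= g j x].
  rewrite -[X in measurable X]setTI -[X in _ `&` X]/(g j @^-1` [set y | 1 / 2 <= y]).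
  apply: (bg j).1 => //.
  by have := @measurable_itv R `[1 / 2, +oo[; rewrite set_itvE.
have key (Q : probability T R) (V : R) j (h : T -> R) : bdm h ->
    \int[Q]_x ((h x * lacunary_mean c (N j)) ^+ 2) <= V * (N j)%:R -> V <= `|B| + 4 ->
    4 * \int[Q]_x (h x ^+ 2) <= 1 / 2 ^+ j.
  move=> bh h1 VB.
  have : \int[Q]_x (h x ^+ 2) * lacunary_mean c (N j) ^+ 2 <= V * (N j)%:R.
    rewrite mulrC -meanZ; last exact: bdmX.
    by under eq_Rintegral do rewrite mulrC -exprMn.
  have p2 : 0 < 2 ^+ j :> R by exact: exprn_gt0.
  rewrite ler_pdivlMr// => h2.
  have h3 : 0 < lacunary_mean c (N j) ^+ 2 by exact: exprn_gt0.
  rewrite -(ler_pM2r h3) mul1r (le_trans _ (MN j))//.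
  set I := \int[Q]_x _ in h2 *; set L := _ ^+ 2 in h2 *; set n := (N j)%:R in h2 *.
  have -> : 4 * I * 2 ^+ j * L = (I * L) * (4 * 2 ^+ j) by ring.
  have -> : 4 * (`|B| + 4) * 2 ^+ j * n = ((`|B| + 4) * n) * (4 * 2 ^+ j) by ring.
  rewrite ler_pM2r; last by rewrite mulr_gt0.
  by rewrite (le_trans h2)// ler_wpM2r.
apply: (@singular_measures_of_sets _ _ P haar
  (fun j => [set x | 1 / 2 <= g j x])) => // j.
- have gA x : (~` [set x | 1 / 2 <= g j x]) x -> 1 / 2 <= `|g j x - 1|.
    by move=> /= /negP; rewrite -ltNge => gx; rewrite ler0_norm; lra.
  apply: (le_trans (mean_chebyshev P (measurableC (mA j)) (bg1 j) gA)).
  rewrite lee_fin; apply: (key _ (`|B| + 4)) => //.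
  apply: le_trans (variance_le hc c1 hB (N j)); rewrite le_eqVlt; apply/orP; left.
  apply/eqP; apply: eq_Rintegral => x _.
  by rewrite /g mulrBl mul1r mulfVK// gt_eqF.
- have gA x : [set x | 1 / 2 <= g j x] x -> 1 / 2 <= `|g j x|.
    by move=> /= gx; rewrite ger0_norm//; lra.
  apply: (le_trans (mean_chebyshev haar (mA j) (bg j) gA)).
  rewrite lee_fin; apply: (key _ (`|0| + 4)) => //; last by rewrite normr0 lerD2r.
  (* Under Haar measure the covariances vanish, so [B] = 0 is allowed: for [d] > 0 the frequencies
     3^(l+d) + 3^l and 3^(l+d) - 3^l are nonzero. *)
  have := @variance_le haar _ 0 haar_cos_coefs _ _ (N j).
  rewrite /lacunary_mean big1 => [|m _]; last first.
    by rewrite eqz_nat expn_eq0.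
  under eq_Rintegral do rewrite subr0.
  move=> h; apply: le_trans (h _ _).
  + rewrite le_eqVlt; apply/orP; left; apply/eqP; apply: eq_Rintegral => x _.
    by rewrite /g mulfVK// gt_eqF.
  + by move=> n; case: (n == 0); rewrite ?normr1 ?normr0.
  + move=> l d d0 s; rewrite mul0r.
    rewrite [(3 ^ (l + d))%N%:Z == 0]eqz_nat expn_eq0/= mul0r subr0.
    rewrite (_ : (_ == 0) = false) ?normr0//.
    apply/negbTE; rewrite addr_eq0; apply/eqP => h'.
    have : (3 ^ (l + d) = 3 ^ l)%N.
      have := congr1 absz h'; rewrite absz_nat => ->.
      by rewrite abszN abszM abszX/= exp1n mul1n.
    move/eqP; rewrite eqn_exp2l// -{2}[l]addn0 eqn_add2l => /eqP d0'.
    by rewrite d0' in d0.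
Qed.

End singularity.

(** * The digit measure *)

(** With N = 2^r terms, 2r + 4 is twice the inverse of the lower bound for the bias: powers of it
    must lose against N. *)
Lemma poly_le_exp2 (K p : nat) : (0 < p)%N ->
  exists r, (K * (2 * r + 4) ^ p <= 2 ^ r)%N.
Proof.
(* One factor 2^(s p) pays for [K]; the other pays for the power, because 2r + 4 = 8pt + 4 <= 8p (t
   + 1) <= 2^t 2^t = 2^s. *)
move=> p0; pose t := (8 * p + K)%N; pose s := (2 * t)%N.
exists (s * p + s * p)%N; rewrite expnD leq_mul//.
  rewrite (leq_trans _ (leq_pexp2l _ (_ : t <= s * p)%N))//.
    by rewrite (leq_trans _ (ltnW (ltn_expl t _)))// /t leq_addl.
  by rewrite /s -mulnA mulnCA -[leqLHS]muln1 leq_mul// muln_gt0.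
rewrite expnM leq_exp2r//.
have t1 : (t.+1 <= 2 ^ t)%N by exact: ltn_expl.
have t8 : (8 * p <= 2 ^ t)%N by rewrite (leq_trans _ (ltnW t1))// leq_addr.
have := leq_mul t8 t1; rewrite -expnD addnn -mul2n -/s; apply: leq_trans.
have -> : (2 * (s * p + s * p) + 4 = 8 * p * t + 4)%N.
  by rewrite /s addnn -mul2n !mulnA -mulnA [(t * p)%N]mulnC mulnA.
by rewrite mulnS [leqRHS]addnC leq_add2l (@leq_mul 4 1 8 p).
Qed.

Section bias.
Variable R : realType.

(** A dyadic logarithm, constant on blocks, so that the bounds below need only integer arithmetic.
    The added 2 keeps the value at most 1/2, already at [m] = 0. *)
Definition bias (m : nat) : R := (trunc_log 2 m.+1 + 2)%:R^-1.

Lemma bias_gt0 m : 0 < bias m.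
Proof. by rewrite invr_gt0 ltr0n addnS. Qed.

Lemma bias_le_half m : bias m <= 1 / 2.
Proof.
by rewrite div1r lef_pV2 ?posrE ?ltr0n ?addnS// ler_nat.
Qed.

Lemma bias01 m : 0 <= bias m < 1.
Proof.
rewrite (ltW (bias_gt0 m))/=; apply: le_lt_trans (bias_le_half m) _; lra.
Qed.

Lemma bias_ge r m : (m < 2 ^ r)%N -> (r + 2)%:R^-1 <= bias m.
Proof.
move=> mr; rewrite lef_pV2 ?posrE ?ltr0n ?addn2// ler_nat !ltnS.
by rewrite -(@leq_exp2l 2)// (leq_trans (trunc_logP _ _)).
Qed.

Lemma bias_le r m : (2 ^ r <= m)%N -> bias m <= (r + 2)%:R^-1.
Proof.
move=> mr; rewrite lef_pV2 ?posrE ?ltr0n ?addn2// ler_nat !ltnS.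
by apply: trunc_log_max => //; exact: leqW.
Qed.

End bias.

Section digit_measure.
Variable R : realType.
Local Notation RR := (measurableTypeR R).
Local Notation T := (circle R).
Local Notation e := (@bias R).

Definition digit_point (u : R) : T := angle (phi e 0 u).

Lemma measurable_digit_point : measurable_fun setT (digit_point : RR -> T).
Proof. exact: (measurableT_comp (@measurable_angle R) (measurable_phi e 0)). Qed.

HB.instance Definition _ :=
  isMeasurableFun.Build _ _ _ _ (digit_point : RR -> T) measurable_digit_point.

Definition digit_measure : probability T R := distribution (unif R) digit_point.

Definition digit_coef (n : int) : R := cos_coef e 0 (2 * pi * n%:~R).

Lemma digit_measure_coefs : has_cos_coefs digit_measure digit_coef.
Proof.
move=> n; rewrite !mean_distribution; [|exact: bdm_sin_cval|exact: bdm_cos_cval].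
have E u : n%:~R * (2 * pi * phi e 0 u) = 2 * pi * n%:~R * phi e 0 u by ring.
split.
  by under eq_Rintegral do rewrite cos_cval_wrap E.
under eq_Rintegral do rewrite sin_cval_wrap E.
exact: (sin_coef_eq0 (@bias01 R)).
Qed.

Lemma digit_coef_le1 n : `|digit_coef n| <= 1.
Proof. exact: cos_coef_le1. Qed.

Lemma digit_coef_pow3 m : digit_coef (3 ^ m)%N%:Z = cos_coef e m (2 * pi).
Proof.
have := cos_coef_pow3 (@bias01 R) 0 m 1; rewrite add0n !mulr1 => <-.
by rewrite /digit_coef -natrX.
Qed.

Lemma digit_coef_pow3_ge m : e m / 2 <= digit_coef (3 ^ m)%N%:Z.
Proof. by rewrite digit_coef_pow3 (cos_coef_ge (@bias01 R)). Qed.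

Lemma cos_coefN j t : cos_coef e j (- t) = cos_coef e j t.
Proof. by apply: eq_Rintegral => u _; rewrite mulNr cosN. Qed.

Lemma digit_coef_decouple l d (s : bool) :
  `|digit_coef ((3 ^ (l + d))%N%:Z + (-1) ^+ s * (3 ^ l)%N%:Z) -
    digit_coef (3 ^ (l + d))%N%:Z * digit_coef (3 ^ l)%N%:Z| <= 2 * pi / 3 ^+ d.
Proof.
rewrite !digit_coef_pow3.
pose x : R := (-1) ^+ s * (2 * pi).
have hx : `|x| = 2 * pi.
  by rewrite /x normrM normrX normrN1 expr1n mul1r ger0_norm// mulr_ge0// pi_ge0.
have cx : cos_coef e l x = cos_coef e l (2 * pi).
  by rewrite /x; case: (s); rewrite ?expr1 ?expr0 ?mul1r// mulN1r cos_coefN.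
have := cos_coef_decouple (@bias01 R) d l x; rewrite hx cx; congr (`|_ - _| <= _).
rewrite /digit_coef.
(* The frequency factors as 3^l times 3^d + 1 or 3^d - 1, a natural number as [cos_coef_pow3]
   requires; this removes the first [l] digits. *)
have [n hn] : exists n : nat, ((3 ^ d)%N%:Z + (-1) ^+ s = n%:Z)%R.
  case: (s); last by exists (3 ^ d + 1)%N; rewrite expr0 PoszD.
  by exists (3 ^ d - 1)%N; rewrite expr1 subzn// expn_gt0.
transitivity (cos_coef e 0 (2 * pi * (3 ^+ l * n%:R))).
  rewrite (cos_coef_pow3 (@bias01 R)) add0n; congr cos_coef.
  have : (n%:Z%:~R = (3 ^ d)%N%:R + (-1) ^+ s :> R).
    by rewrite -hn intrD rmorphXn/= rmorphN1.
  by move=> h; rewrite [n%:R]h natrX /x; ring.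
congr (cos_coef _ _ (_ * _)).
have -> : (3 ^ (l + d))%N%:Z + (-1) ^+ s * (3 ^ l)%N%:Z = (3 ^ l)%N%:Z * n%:Z.
  by rewrite -hn expnD PoszM; ring.
by rewrite intrM -natrX.
Qed.

(** Carries the decoupling estimate over to the k-th powers of the coefficients, at the cost of a
    factor [k]. *)
Lemma normr_expB_le (x y : R) k : `|x| <= 1 -> `|y| <= 1 ->
  `|x ^+ k - y ^+ k| <= k%:R * `|x - y|.
Proof.
move=> x1 y1; elim: k => [|k IH]; first by rewrite !expr0 subrr normr0 mul0r.
have -> : x ^+ k.+1 - y ^+ k.+1 = x * (x ^+ k - y ^+ k) + (x - y) * y ^+ k.
  by rewrite !exprS; ring.
rewrite (le_trans (ler_normD _ _))// -[k.+1%:R]natr1 [(k%:R + 1) * _]mulrDl mul1r lerD//.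
  by rewrite normrM (le_trans _ IH)// ler_piMl.
by rewrite normrM ler_piMr// normrX exprn_ile1.
Qed.

Lemma singular_of_digit_powers (P : probability T R) k : (0 < k)%N ->
  has_cos_coefs P (fun n => digit_coef n ^+ k) -> singular P.
Proof.
move=> k0 hP; apply: (singular_of_cos_coefs (B := k%:R * (2 * pi)) hP).
- by move=> n; rewrite normrX exprn_ile1// digit_coef_le1.
- move=> l d d0 s; rewrite -exprMn.
  rewrite (le_trans (normr_expB_le _ _ _)) ?digit_coef_le1//.
    by rewrite normrM -[1]mulr1 ler_pM ?digit_coef_le1.
  by rewrite -mulrA ler_wpM2l// digit_coef_decouple.
move=> K; have kk : (0 < k * 2)%N by rewrite muln_gt0 k0.
(* For m < 2^r each coefficient is at least 1/q with q = 2r + 4, so the mean is at least 2^r / q^k;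
   the exponent 2k comes from squaring it. *)
have [r hr] := poly_le_exp2 (Num.truncn `|K|).+1 kk; exists (2 ^ r)%N.
set q : R := (2 * r + 4)%:R; have q0 : 0 < q by rewrite ltr0n addnS.
have Kq : K * q ^+ (k * 2) <= 2 ^+ r.
  rewrite (@le_trans _ _ ((Num.truncn `|K|).+1%:R * q ^+ (k * 2)))//.
    rewrite ler_wpM2r ?exprn_ge0 ?(ltW q0)// (le_trans (ler_norm K))//.
    by apply/ltW/truncnS_gt.
  by rewrite /q -!natrX -natrM ler_nat.
have w0 : 0 < (q ^+ k)^-1 by rewrite invr_gt0 exprn_gt0.
have hM : 2 ^+ r * (q ^+ k)^-1 <= lacunary_mean (fun n => digit_coef n ^+ k) (2 ^ r).
  have -> : 2 ^+ r * (q ^+ k)^-1 = \sum_(m < 2 ^ r) (q ^+ k)^-1.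
    by rewrite sumr_const card_ord -natrX mulr_natl.
  apply: ler_sum => m _; rewrite -exprVn lerXn2r ?nnegrE ?invr_ge0 ?(ltW q0)//.
    by rewrite (le_trans _ (digit_coef_pow3_ge m))// divr_ge0// (ltW (bias_gt0 _ _)).
  rewrite (le_trans _ (digit_coef_pow3_ge m))// ler_pdivlMr//.
  rewrite (le_trans _ (bias_ge R (ltn_ord m)))//.
  have -> : q = (r + 2)%:R * 2 by rewrite /q -natrM mulnDl mulnC.
  by rewrite invfM mulfVK.
have p0 : 0 < 2 ^+ r * (q ^+ k)^-1 by rewrite mulr_gt0// exprn_gt0.
split; first exact: lt_le_trans hM.
apply: (@le_trans _ _ ((2 ^+ r * (q ^+ k)^-1) ^+ 2)); last first.
  by rewrite lerXn2r ?nnegrE ?(ltW p0)// (le_trans (ltW p0)).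
rewrite natrX exprMn expr2 -mulrA mulrC ler_wpM2l ?exprn_ge0//.
by rewrite exprVn -exprM ler_pdivlMr// exprn_gt0.
Qed.

Lemma singular_convpow k : (0 < k)%N -> singular (convpow digit_measure k).
Proof.
move=> k0; apply: (singular_of_digit_powers k0).
exact: (convpow_cos_coefs k digit_measure_coefs).
Qed.

Lemma singular_digit_measure : singular digit_measure.
Proof.
apply: (@singular_of_digit_powers _ 1) => // n.
by rewrite expr1; exact: digit_measure_coefs.
Qed.

Lemma cos_coef_scale j m t :
  `|cos_coef e j t| <= `|cos_coef e (j + m) (t / 3 ^+ m)|.
Proof.
elim: m j t => [|m IH] j t; first by rewrite addn0 expr0 divr1.
rewrite (cos_coef_rec (@bias01 R)) normrM.
rewrite (le_trans (ler_piMl _ (symbol_le1 (@bias01 R) _ _)))//.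
by rewrite (le_trans (IH _ _))// addSnnS exprS invfM mulrA.
Qed.

(** Only [K] consecutive digits are kept, all of index at least [J]. Their biases cost at most
    [K * eta], and their uniform parts form a Dirichlet kernel of 3^K points away from its peaks. *)
Lemma digit_coef_le K J (eta : R) (n : nat) : (forall m, (J <= m)%N -> e m <= eta) ->
  (3 ^ (J + K) <= n)%N -> `|digit_coef n%:Z| <= 2 / 3 ^+ K + K%:R * eta.
Proof.
move=> hJ hn; have n0 : (0 < n)%N by rewrite (leq_trans _ hn)// expn_gt0.
(* The factor 6 puts n / 3^l between 1/6 and 1/2, hence s / 2 between pi / 6 and pi / 2, where the
   sine is at least 1/2. *)
pose l := trunc_log 3 (6 * n).
have l1 : (3 ^ l <= 6 * n)%N by rewrite trunc_logP// muln_gt0.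
have l2 : (6 * n < 3 ^ l.+1)%N by exact: trunc_log_ltn.
have lJK : (J + K <= l)%N.
  by apply: trunc_log_max => //; rewrite (leq_trans hn)// leq_pmull.
have lK : (K <= l)%N by rewrite (leq_trans _ lJK)// leq_addl.
set t := 2 * pi * n%:Z%:~R : R; pose s := t / 3 ^+ l.
rewrite (le_trans (cos_coef_scale 0 (l - K) t))// add0n.
have -> : t / 3 ^+ (l - K) = 3 ^+ K * s.
  rewrite /s -{2}(subnKC lK) exprD; field.
  by rewrite !expf_neq0.
rewrite (le_trans (cos_coef_window (@bias01 R) _ _ _))// lerD//; last first.
  apply: (@le_trans _ _ (\sum_(i < K) eta)).
    apply: ler_sum => i _; apply: hJ; rewrite (leq_trans _ (leq_addr _ _))//.
    by rewrite leq_subRL// addnC.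
  by rewrite sumr_const card_ord mulr_natl.
have p0 := @pi_gt0 R.
have s2 : 1 / 2 <= `|sin (s / 2)|.
  rewrite (le_trans _ (ler_norm _))// sin_ge_half//.
  have k0 : 0 < 3 ^+ l :> R by exact: exprn_gt0.
  have -> : s / 2 = pi * (n%:R / 3 ^+ l) by rewrite /s /t; field; rewrite gt_eqF.
  have h1 : 1 / 6 <= n%:R / 3 ^+ l :> R.
    rewrite ler_pdivlMr// mulrC div1r ler_pdivrMr// -natrX -natrM ler_nat.
    by rewrite mulnC.
  have h2 : n%:R / 3 ^+ l <= 1 / 2 :> R.
    rewrite ler_pdivrMr// -natrX mulrC div1r ler_pdivlMr// -natrM ler_nat.
    move: l2; rewrite expnS => /ltnW.
    by rewrite -[(6 * n)%N]/(3 * 2 * n)%N -mulnA leq_pmul2l// mulnC.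
  by apply/andP; split; nra.
rewrite ler_pdivlMr ?exprn_gt0// mulrC.
have h := prod_dirichlet3 s K.
set P := \prod_(i < K) _ in h *.
have P0 : 0 <= 3 ^+ K * P.
  by rewrite mulr_ge0 ?exprn_ge0// prodr_ge0// => i _; exact: dirichlet3_ge0.
have : 3 ^+ K * P * `|sin (s / 2)| <= 1 by rewrite h sin_max.
by nra.
Qed.

Lemma digit_coefN n : digit_coef (- n) = digit_coef n.
Proof. by rewrite /digit_coef intrN mulrN cos_coefN. Qed.

Lemma digit_coef_cvg0 (eps : R) : 0 < eps ->
  exists N : nat, forall n : int, (N <= `|n|)%N -> `|digit_coef n| < eps.
Proof.
(* [K] is fixed first, so that 2 / 3^K < eps / 2; then [r] makes the bias beyond 2^r smaller than
   eps / (2K). *)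
move=> e0; pose K := (Num.truncn (4 / eps)).+1; pose r := Num.truncn (4 * K%:R / eps).
exists (3 ^ (2 ^ r + K))%N => n hn.
have -> : digit_coef n = digit_coef `|n|%N%:Z.
  by case: (intP n) => // k; rewrite digit_coefN abszN.
rewrite (le_lt_trans (@digit_coef_le K (2 ^ r) (r + 2)%:R^-1 _ _ hn))//.
  by move=> m; exact: bias_le.
have K1 : 4 / eps < K%:R by exact: truncnS_gt.
have K2 : K%:R < 3 ^+ K :> R by rewrite -natrX ltr_nat ltn_expl.
have h1 : 2 / 3 ^+ K < eps / 2.
  rewrite ltr_pdivrMr ?exprn_gt0//.
  by move: K1; rewrite ltr_pdivrMr// => K1; nra.
have h2 : K%:R * (r + 2)%:R^-1 < eps / 2.
  rewrite ltr_pdivrMr ?ltr0n ?addn2//.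
  have : 4 * K%:R / eps < r.+1%:R by exact: truncnS_gt.
  rewrite ltr_pdivrMr// => h.
  have : r.+1%:R < (r + 2)%:R :> R by rewrite ltr_nat addn2.
  have : 0 <= K%:R :> R by [].
  rewrite addn2; nra.
lra.
Qed.

Lemma rajchman_digit_measure : rajchman digit_measure.
Proof.
move=> eps e0; have [N hN] := digit_coef_cvg0 e0; exists N => n hn.
rewrite /fourier_coef (digit_measure_coefs n).1 (digit_measure_coefs n).2 oppr0.
rewrite normc_def/= expr0n/= addr0 sqrtr_sqr ltcR.
exact: hN.
Qed.

End digit_measure.

(** * Hypercontractivity *)

(** On the cyclic group of order three the averaging keeps the mean [m] and multiplies deviations
    from it by [e]. The terms in m^2 q alone require e^2 <= 1/3; taking e <= 1/2 leaves a margin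
    that absorbs the odd term in [m * w]. *)
Lemma three_point_ineq (R : realFieldType) (e a b c : R) : 0 <= e <= 1 / 2 ->
  (((1 - e) / 3 * a + (1 + 2 * e) / 3 * b + (1 - e) / 3 * c) ^+ 4 +
   ((1 - e) / 3 * b + (1 + 2 * e) / 3 * c + (1 - e) / 3 * a) ^+ 4 +
   ((1 - e) / 3 * c + (1 + 2 * e) / 3 * a + (1 - e) / 3 * b) ^+ 4) / 3 <=
  ((a ^+ 2 + b ^+ 2 + c ^+ 2) / 3) ^+ 2.
Proof.
move=> /andP[e0 e1].
pose m := (a + b + c) / 3; pose x := b - m; pose y := c - m.
have -> : (1 - e) / 3 * a + (1 + 2 * e) / 3 * b + (1 - e) / 3 * c = m + e * x.
  by rewrite /x /m; field.
have -> : (1 - e) / 3 * b + (1 + 2 * e) / 3 * c + (1 - e) / 3 * a = m + e * y.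
  by rewrite /y /m; field.
have -> : (1 - e) / 3 * c + (1 + 2 * e) / 3 * a + (1 - e) / 3 * b = m - e * (x + y).
  by rewrite /x /y /m; field.
have -> : a = m - (x + y) by rewrite /x /y /m; field.
have -> : b = m + x by rewrite /x; ring.
have -> : c = m + y by rewrite /y; ring.
(* The values have mean m and central moments 2q/3, -w and 2q^2/3. *)
pose q := x ^+ 2 + x * y + y ^+ 2; pose w := x * y * (x + y).
have q0 : 0 <= q by rewrite /q; nra.
have -> : ((m + e * x) ^+ 4 + (m + e * y) ^+ 4 + (m - e * (x + y)) ^+ 4) / 3 =
   m ^+ 4 + 4 * e ^+ 2 * m ^+ 2 * q - 4 * e ^+ 3 * m * w + 2 / 3 * e ^+ 4 * q ^+ 2.
  by rewrite /q /w; field.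
have -> : (((m - (x + y)) ^+ 2 + (m + x) ^+ 2 + (m + y) ^+ 2) / 3) ^+ 2 =
  m ^+ 4 + 4 / 3 * m ^+ 2 * q + 4 / 9 * q ^+ 2 by rewrite /q; field.
(* 27 w^2 <= 4 q^3 is the discriminant of the cubic with roots -(x + y), x, y. *)
have wq : w ^+ 2 <= 4 / 27 * q ^+ 3.
  rewrite -subr_ge0 (_ : _ - _ =
    1 / 27 * ((x - y) * (2 * x + y) * (x + 2 * y)) ^+ 2); last by rewrite /q /w; field.
  by rewrite mulr_ge0// sqr_ge0.
have e2 : e ^+ 2 <= 1 / 4 by nra.
have e3 : 0 <= e ^+ 3 <= 1 / 8 by rewrite exprn_ge0//= exprSr; nra.
have e4 : e ^+ 4 <= 1 / 16 by rewrite (_ : e ^+ 4 = (e ^+ 2) ^+ 2); [nra|ring].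
move: e3 => /andP[e30 e3]; clearbody m.
set E2 := e ^+ 2 in e2 *; set E3 := e ^+ 3 in e30 e3 *; set E4 := e ^+ 4 in e4 *.
have [qle|qgt] := leP q 0.
  have qz : q = 0 by lra.
  have wz : w = 0.
    apply/eqP; rewrite -sqrf_eq0 eq_le sqr_ge0 andbT.
    by move: wq; rewrite qz; lra.
  by rewrite qz wz; lra.
(* Multiplying by [q] turns the claim into a quadratic inequality in [m * q], whose cross term is
   controlled by [wq]. *)
rewrite -subr_ge0 -(pmulr_rge0 _ qgt).
(* Completing the square costs 16 E3^2 w^2, at most w^2 / 4 since E3 <= 1/8, hence at most q^3 /
   27. *)
have h1 : 0 <= 1 / 3 * (m * q) ^+ 2 + 4 * E3 * (m * q) * w + 1 / 4 * q ^+ 3.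
  set X := m * q.
  have : 0 <= (X / 2 + 4 * E3 * w) ^+ 2 by exact: sqr_ge0.
  have : 0 <= (1 / 64 - E3 ^+ 2) * w ^+ 2 by rewrite mulr_ge0 ?sqr_ge0//; nra.
  have : 0 <= X ^+ 2 by exact: sqr_ge0.
  have : 0 <= w ^+ 2 by exact: sqr_ge0.
  by nra.
have h2 : 0 <= (1 / 4 - E2) * (m * q) ^+ 2 by rewrite mulr_ge0 ?sqr_ge0//; lra.
have h3 : 0 <= (1 / 16 - E4) * q ^+ 3 by rewrite mulr_ge0 ?exprn_ge0//; lra.
have h4 : 0 <= q ^+ 3 by rewrite exprn_ge0.
(* The 4/3 is split as 1/3 + 4 * 1/4; the 4/9 pays 1/4 to [h1] and 1/24 to [h3], with a positive
   remainder. *)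
have -> : q * (m ^+ 4 + 4 / 3 * m ^+ 2 * q + 4 / 9 * q ^+ 2 -
    (m ^+ 4 + 4 * E2 * m ^+ 2 * q - 4 * E3 * m * w + 2 / 3 * E4 * q ^+ 2)) =
  (1 / 3 * (m * q) ^+ 2 + 4 * E3 * (m * q) * w + 1 / 4 * q ^+ 3) +
  4 * ((1 / 4 - E2) * (m * q) ^+ 2) + 2 / 3 * ((1 / 16 - E4) * q ^+ 3) +
  (4 / 9 - 1 / 4 - 1 / 24) * q ^+ 3 by field.
by lra.
Qed.

(** * Averages over finite cosets *)

Section operators.
Variable R : realType.
Local Notation RR := (measurableTypeR R).
Implicit Types (f g h : RR -> R) (u v : R).

(** Balanced ternary expansions of length [n]: representatives of 3^-n Z modulo Z, listed so that
    the last digit splits off. *)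
Fixpoint shifts (n : nat) : seq R :=
  if n is n'.+1 then
    [seq k + (3 ^+ n)^-1 | k <- shifts n'] ++ shifts n' ++
    [seq k - (3 ^+ n)^-1 | k <- shifts n']
  else [:: 0].

(* The average over the coset u + 3^-n Z, for functions of period one. *)
Definition coset_mean (n : nat) g (u : R) : R :=
  (\sum_(k <- shifts n) g (u + k)) / 3 ^+ n.

Lemma coset_mean0 g u : coset_mean 0 g u = g u.
Proof. by rewrite /coset_mean big_seq1 addr0 expr0 divr1. Qed.

Lemma coset_meanS n g u : coset_mean n.+1 g u =
  (coset_mean n g (u + (3 ^+ n.+1)^-1) + coset_mean n g u +
   coset_mean n g (u - (3 ^+ n.+1)^-1)) / 3.
Proof.
rewrite /coset_mean /= !big_cat !big_map/= exprS.
have E (d : R) : \sum_(k <- shifts n) g (u + (k + d)) =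
    \sum_(k <- shifts n) g (u + d + k).
  by apply: eq_bigr => k _; rewrite addrAC addrA.
rewrite !E; field.
by rewrite expf_neq0.
Qed.

Lemma coset_meanD n g h u :
  coset_mean n (fun x => g x + h x) u = coset_mean n g u + coset_mean n h u.
Proof. by rewrite /coset_mean big_split/= mulrDl. Qed.

Lemma coset_meanZ n (c : R) g u :
  coset_mean n (fun x => c * g x) u = c * coset_mean n g u.
Proof. by rewrite /coset_mean -mulr_sumr mulrA. Qed.

Lemma coset_mean_le n g h u : (forall x, g x <= h x) ->
  coset_mean n g u <= coset_mean n h u.
Proof.
move=> gh; rewrite ler_wpM2r ?invr_ge0 ?exprn_ge0//.
by apply: ler_sum.
Qed.

Lemma coset_mean_ge0 n g u : (forall x, 0 <= g x) -> 0 <= coset_mean n g u.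
Proof.
by move=> g0; rewrite divr_ge0 ?exprn_ge0//; apply: sumr_ge0.
Qed.

Lemma coset_mean_translate n g u d :
  coset_mean n (fun x => g (x + d)) u = coset_mean n g (u + d).
Proof.
by rewrite /coset_mean; congr (_ / _); apply: eq_bigr => k _; rewrite addrAC.
Qed.

(** Three steps of length 3^-(n+1) make one of length 3^-n, a period at the previous level, so a
    step permutes the three terms of [coset_meanS] cyclically. This is how carries are handled. *)
Lemma coset_mean_periodic n g u : periodic1 g ->
  coset_mean n g (u + (3 ^+ n)^-1) = coset_mean n g u.
Proof.
move=> pg; elim: n u => [|n IH] u.
  by rewrite !coset_mean0 expr0 invr1 (pg 1%Z).
rewrite !coset_meanS; set d := (3 ^+ n.+1)^-1.
have -> : coset_mean n g (u + d + d) = coset_mean n g (u - d).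
  rewrite -[RHS]IH; congr coset_mean; rewrite /d exprS; field.
  by rewrite expf_neq0.
by rewrite addrK; congr (_ / _); ring.
Qed.

Lemma coset_mean_CS n g h u :
  coset_mean n (fun x => g x * h x) u ^+ 2 <=
  coset_mean n (fun x => g x ^+ 2) u * coset_mean n (fun x => h x ^+ 2) u.
Proof.
set a := coset_mean n (fun x => g x ^+ 2) u.
set b := coset_mean n (fun x => g x * h x) u.
set c := coset_mean n (fun x => h x ^+ 2) u.
have key t : 0 <= a - 2 * t * b + t ^+ 2 * c.
  have -> : a - 2 * t * b + t ^+ 2 * c =
      coset_mean n (fun x => (g x - t * h x) ^+ 2) u.
    rewrite -mulNr -!coset_meanZ -!coset_meanD; congr (_ / _).
    by apply: eq_bigr => k _; ring.
  by apply: coset_mean_ge0 => x; exact: sqr_ge0.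
have c0 : 0 <= c by apply: coset_mean_ge0 => x; exact: sqr_ge0.
have [cz|cn] := eqVneq c 0.
  have [->|bn] := eqVneq b 0; first by rewrite cz mulr0 expr0n.
  (* When [c] = 0 the expression is affine in [t], and this [t] gives it the value -1. *)
  have := key ((a + 1) / (2 * b)); rewrite cz mulr0 addr0.
  have -> : 2 * ((a + 1) / (2 * b)) * b = a + 1 by field.
  by lra.
have := key (b / c).
have -> : a - 2 * (b / c) * b + (b / c) ^+ 2 * c = (a * c - b ^+ 2) / c by field.
have cp : 0 < c by rewrite lt_neqAle eq_sym cn.
by rewrite pmulr_lge0 ?invr_gt0// subr_ge0.
Qed.

Variable e : nat -> R.
Hypothesis e01 : forall j, 0 <= e j <= 1 / 2.
Let e01' j : 0 <= e j < 1.
Proof. by have /andP[-> ?] := e01 j; rewrite /=; lra. Qed.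

Definition digit_mean (n : nat) g u : R :=
  sidew (e n) * g (u + (3 ^+ n.+1)^-1) + midw (e n) * g u +
  sidew (e n) * g (u - (3 ^+ n.+1)^-1).

Fixpoint digit_means (n : nat) g : R -> R :=
  if n is n'.+1 then digit_means n' (digit_mean n' g) else g.

(** Minkowski's inequality in L^2 of a coset, for three translates with nonnegative weights: the
    squares are expanded and each mixed term bounded by Cauchy-Schwarz. *)
Lemma coset_mean_minkowski n m g u :
  coset_mean n (fun x => digit_mean m g x ^+ 2) u <=
  digit_mean m (fun x => Num.sqrt (coset_mean n (fun y => g y ^+ 2) x)) u ^+ 2.
Proof.
have /andP[e0 e1] := e01' m.
have s0 := ltW (sidew_gt0 e1); have m0 := ltW (midw_gt0 e0).
rewrite /digit_mean; set d := (3 ^+ m.+1)^-1.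
set s := sidew (e m) in s0 *; set w := midw (e m) in m0 *.
pose G x := Num.sqrt (coset_mean n (fun y => g y ^+ 2) x).
have G0 x : 0 <= G x by exact: sqrtr_ge0.
have A0 x : 0 <= coset_mean n (fun y => g y ^+ 2) x.
  by apply: coset_mean_ge0 => y; exact: sqr_ge0.
have G2 x : G x ^+ 2 = coset_mean n (fun y => g y ^+ 2) x by rewrite sqr_sqrtr.
have CS a b : coset_mean n (fun x => g (x + a) * g (x + b)) u <=
    G (u + a) * G (u + b).
  have := coset_mean_CS n (fun x => g (x + a)) (fun x => g (x + b)) u.
  rewrite (coset_mean_translate n (fun x => g x ^+ 2)).
  rewrite (coset_mean_translate n (fun x => g x ^+ 2)) -!G2 -exprMn => h.
  have p : 0 <= G (u + a) * G (u + b) by rewrite mulr_ge0.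
  rewrite (le_trans (ler_norm _))// -(ler_pXn2r (_ : 0 < 2)%N) ?nnegrE//.
  by rewrite real_normK// num_real.
rewrite -/(G u) -/(G (u + d)) -/(G (u - d)).
have -> : coset_mean n (fun x => (s * g (x + d) + w * g x + s * g (x - d)) ^+ 2) u =
  s ^+ 2 * coset_mean n (fun x => g (x + d) * g (x + d)) u +
  w ^+ 2 * coset_mean n (fun x => g (x + 0) * g (x + 0)) u +
  s ^+ 2 * coset_mean n (fun x => g (x + - d) * g (x + - d)) u +
  2 * s * w * coset_mean n (fun x => g (x + d) * g (x + 0)) u +
  2 * s * w * coset_mean n (fun x => g (x + 0) * g (x + - d)) u +
  2 * s ^+ 2 * coset_mean n (fun x => g (x + d) * g (x + - d)) u.
  rewrite -!coset_meanZ -!coset_meanD; congr (_ / _).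
  by apply: eq_bigr => k _; rewrite addr0; ring.
have -> : (s * G (u + d) + w * G u + s * G (u - d)) ^+ 2 =
  s ^+ 2 * (G (u + d) * G (u + d)) + w ^+ 2 * (G (u + 0) * G (u + 0)) +
  s ^+ 2 * (G (u + - d) * G (u + - d)) + 2 * s * w * (G (u + d) * G (u + 0)) +
  2 * s * w * (G (u + 0) * G (u + - d)) + 2 * s ^+ 2 * (G (u + d) * G (u + - d)).
  by rewrite addr0; ring.
have sw : 0 <= 2 * s * w by rewrite mulr_ge0// mulr_ge0.
have ss : 0 <= 2 * s ^+ 2 by rewrite mulr_ge0// sqr_ge0.
have H r a b : 0 <= r -> r * coset_mean n (fun x => g (x + a) * g (x + b)) u <=
    r * (G (u + a) * G (u + b)) by move=> r0; rewrite ler_wpM2l.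
have s2 := sqr_ge0 s; have w2 := sqr_ge0 w.
by rewrite !lerD ?H.
Qed.

(** The finest digit is split off: the induction hypothesis acts on each coset of 3^-n Z, Minkowski
    moves the average over the last digit outside the L^2 norms [G], and [three_point_ineq] applies
    to the three values of [G]. *)
Lemma coset_mean_hypercontractive n g u : periodic1 g ->
  coset_mean n (fun x => digit_means n g x ^+ 4) u <=
  coset_mean n (fun x => g x ^+ 2) u ^+ 2.
Proof.
elim: n g u => [|n IH] g u pg /=.
  by rewrite !coset_mean0 -exprM.
have pd : periodic1 (digit_mean n g).
  move=> k x; rewrite /digit_mean [x + k%:~R + _]addrAC pg pg.
  by rewrite [x + k%:~R - _]addrAC pg.
pose G x := Num.sqrt (coset_mean n (fun y => g y ^+ 2) x).
have A0 x : 0 <= coset_mean n (fun y => g y ^+ 2) x.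
  by apply: coset_mean_ge0 => y; exact: sqr_ge0.
have G2 x : G x ^+ 2 = coset_mean n (fun y => g y ^+ 2) x by rewrite sqr_sqrtr.
have step x : coset_mean n (fun y => digit_means n (digit_mean n g) y ^+ 4) x <=
    digit_mean n G x ^+ 4.
  rewrite (le_trans (IH _ _ pd))// (_ : 4 = 2 * 2)%N// exprM.
  rewrite lerXn2r ?nnegrE ?sqr_ge0//.
    by apply: coset_mean_ge0 => y; exact: sqr_ge0.
  exact: coset_mean_minkowski.
rewrite !coset_meanS; set d := (3 ^+ n.+1)^-1.
(* 3d = 3^-n is a period of [G], so translation by [d] acts on its values as the cyclic group of
   order three. *)
have pG x : G (x + d + d) = G (x - d).
  rewrite /G; congr Num.sqrt; rewrite -[RHS]coset_mean_periodic; last first.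
    by move=> k y; rewrite pg.
  congr coset_mean; rewrite /d exprS; field.
  by rewrite expf_neq0.
have pG' x : G (x - d - d) = G (x + d) by rewrite -pG !subrK.
rewrite -!G2; apply: (@le_trans _ _ ((digit_mean n G (u + d) ^+ 4 +
    digit_mean n G u ^+ 4 + digit_mean n G (u - d) ^+ 4) / 3)).
  by rewrite ler_wpM2r// !lerD.
rewrite /digit_mean -/d pG pG' addrK subrK /sidew /midw.
have := three_point_ineq (G (u - d)) (G (u + d)) (G u) (e01 n).
set a := G (u + d); set b := G u; set c := G (u - d).
move=> h; apply: le_trans (le_trans h _); rewrite le_eqVlt; apply/orP; left; apply/eqP.
  by congr (_ / _); rewrite [X in X + _]addrC; ring.
by congr (_ ^+ 2); congr (_ / _); ring.
Qed.

End operators.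

(** * Smoothing, and convolution with the tails of the expansion *)

Section averages.
Variable R : realType.
Local Notation RR := (measurableTypeR R).
Implicit Types (f g h : RR -> R) (psi chi : RR -> RR) (u v : R).

(** Convolution with the law of [- psi]. The smoothing ([cell]) and the digit measure ([tail]) are
    both of this form, hence commute by Fubini. *)
Definition avg psi f (u : R) : R := \int[unif R]_v f (u + psi v).

Lemma bdm_translate f (d : R) : bdm f -> bdm (fun u : RR => f (u + d)).
Proof.
by apply: (@bdm_comp _ _ _ _ _ f (fun u : RR => u + d : RR)); exact: measurable_funD.
Qed.

Lemma bdm_add2 f psi : measurable_fun setT psi -> bdm f ->
  bdm (fun z : RR * RR => f (z.1 + psi z.2)).
Proof.
move=> mpsi; apply: (@bdm_comp _ _ _ _ _ f (fun z : RR * RR => z.1 + psi z.2 : RR)).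
by apply: measurable_funD => //; exact: measurableT_comp.
Qed.

Lemma bdm_addl f psi u : measurable_fun setT psi -> bdm f ->
  bdm (fun v : RR => f (u + psi v)).
Proof.
move=> mpsi; apply: (@bdm_comp _ _ _ _ _ f (fun v : RR => u + psi v : RR)).
exact: measurable_funD.
Qed.

Lemma bdm_avg f psi : measurable_fun setT psi -> bdm f -> bdm (avg psi f : RR -> R).
Proof.
move=> mpsi bf.
exact: (@bdm_fubini_l _ _ _ _ _ (unif R) (unif R) _ (bdm_add2 mpsi bf)).
Qed.

Lemma avg_periodic f psi : periodic1 f -> periodic1 (avg psi f).
Proof.
by move=> pf k u; apply: eq_Rintegral => v _; rewrite addrAC pf.
Qed.

Lemma avg_cst psi (c u : R) : avg psi (fun=> c) u = c.
Proof. exact: mean_cst. Qed.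

Lemma avgC f psi chi u :
  measurable_fun setT psi -> measurable_fun setT chi -> bdm f ->
  avg psi (avg chi f) u = avg chi (avg psi f) u.
Proof.
move=> mpsi mchi bf.
rewrite /avg (@mean_fubini _ _ _ _ _ (unif R) (unif R)
  (fun v w => f (u + psi v + chi w))).
  by apply: eq_Rintegral => v _; apply: eq_Rintegral => w _; rewrite addrAC.
apply: (@bdm_comp _ _ _ _ _ f (fun z : RR * RR => u + psi z.1 + chi z.2 : RR)) bf.
apply: measurable_funD; last exact: measurableT_comp.
by apply: measurable_funD => //; exact: measurableT_comp.
Qed.

Lemma avg_sqr_le f psi u : measurable_fun setT psi -> bdm f ->
  avg psi f u ^+ 2 <= avg psi (fun x => f x ^+ 2) u.
Proof. by move=> mpsi bf; apply: mean_sqr_le; exact: bdm_addl. Qed.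

Lemma avg_le f g psi u : measurable_fun setT psi -> bdm f -> bdm g ->
  (forall x, f x <= g x) -> avg psi f u <= avg psi g u.
Proof. by move=> mpsi bf bg fg; apply: mean_le => //; exact: bdm_addl. Qed.

Lemma bdm_coset_mean n f : bdm f -> bdm (coset_mean n f : RR -> R).
Proof.
move=> bf; apply: bdmM; last exact: bdm_cst.
by apply: bdm_sum => k; exact: bdm_translate.
Qed.

Lemma coset_mean_avg n f psi u : measurable_fun setT psi -> bdm f ->
  coset_mean n (avg psi f) u = avg psi (coset_mean n f) u.
Proof.
move=> mpsi bf; have b k v : bdm (fun w : RR => f (v + k + psi w)) by exact: bdm_addl.
rewrite [RHS](_ : _ = \int[unif R]_v
    ((3 ^+ n)^-1 * \sum_(k <- shifts R n) f (u + psi v + k))); last first.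
  by apply: eq_Rintegral => v _; rewrite mulrC.
rewrite {1}/coset_mean meanZ; last first.
  by apply: bdm_sum => k; under [X in bdm X]funext do rewrite addrAC; exact: b.
rewrite mulrC; congr (_ * _); rewrite mean_sum; last first.
  by move=> k; under [X in bdm X]funext do rewrite addrAC; exact: b.
by apply: eq_bigr => k _; apply: eq_Rintegral => v _; rewrite addrAC.
Qed.

Lemma mean_coset_mean n f : bdm f -> periodic1 f ->
  \int[unif R]_u coset_mean n f u = \int[unif R]_u f u.
Proof.
move=> bf pf; elim: n => [|n IH].
  by apply: eq_Rintegral => u _; rewrite coset_mean0.
have bc := bdm_coset_mean n bf.
have pc : periodic1 (coset_mean n f).
  move=> k u; rewrite -coset_mean_translate.
  by congr (_ / _); apply: eq_bigr => j _; rewrite pf.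
have T d : \int[unif R]_u coset_mean n f (u + d) = \int[unif R]_u f u.
  by rewrite -IH -(mean_translate d bc pc); apply: eq_Rintegral => u _; rewrite addrC.
under eq_Rintegral do rewrite coset_meanS mulrC.
have b1 d : bdm (fun u : RR => coset_mean n f (u + d)) by exact: bdm_translate.
rewrite meanZ ?meanD ?T ?IH//; [by field|exact: bdmD|by apply: bdmD => //; exact: bdmD].
Qed.

Definition cell (n : nat) (v : R) : R := (v - 1 / 2) / 3 ^+ n.

Lemma measurable_cell n : measurable_fun setT (cell n : RR -> RR).
Proof. by apply: measurable_funM => //; exact: measurable_funB. Qed.
Hint Resolve measurable_cell : core.

(** An interval is cut into three equal parts, which is the splitting of the uniform measure for
    bias 0. *)
Lemma avg_cell_rec n f u : bdm f -> avg (cell n) f u =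
  (avg (cell n.+1) f (u + (3 ^+ n.+1)^-1) + avg (cell n.+1) f u +
   avg (cell n.+1) f (u - (3 ^+ n.+1)^-1)) / 3.
Proof.
move=> bf; have k0 : 3 ^+ n != 0 :> R by rewrite expf_neq0.
have b : bdm (fun v : RR => f (u + cell n v)) by exact: bdm_addl.
rewrite /avg (mean_unif_split (lexx 0) ltr01 b) /sidew /midw.
have E (a d : R) : (a - 1 / 2) / 3 ^+ n = d + (0 - 1 / 2) / 3 ^+ n.+1 ->
    \int[unif R]_v f (u + cell n (a + (1 - 0) / 3 * v)) =
    \int[unif R]_v f (u + d + cell n.+1 v).
  move=> h; apply: eq_Rintegral => v _; congr f; rewrite -addrA; congr (_ + _).
  rewrite /cell (_ : (_ + _ - _) / _ = (a - 1 / 2) / 3 ^+ n + v / 3 ^+ n.+1).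
    by rewrite h exprS; field.
  by rewrite exprS; field.
rewrite mulr0 addr0 (E 0 (- (3 ^+ n.+1)^-1)); last by rewrite exprS; field.
rewrite (E ((1 - 0) / 3 + 1 / 3) (3 ^+ n.+1)^-1); last by rewrite exprS; field.
have -> : 1 / 3 = (1 - 0) / 3 :> R by rewrite subr0.
rewrite (E ((1 - 0) / 3) 0); last by rewrite exprS; field.
under [X in _ + _ * X + _]eq_Rintegral do rewrite addr0.
by rewrite subr0; field.
Qed.

(** The translates along a coset of an interval of length 3^-n tile the circle. *)
Lemma coset_mean_cell n f u : bdm f -> periodic1 f ->
  coset_mean n (avg (cell n) f) u = \int[unif R]_v f v.
Proof.
move=> bf pf; elim: n u => [|n IH] u.
  rewrite coset_mean0 /avg -(mean_translate (u - 1 / 2) bf pf).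
  by apply: eq_Rintegral => v _; congr f; rewrite /cell expr0; field.
rewrite coset_meanS -(IH u) mulrC.
rewrite -(coset_mean_translate n _ u (3 ^+ n.+1)^-1).
rewrite -(coset_mean_translate n _ u (- (3 ^+ n.+1)^-1)).
rewrite -!coset_meanD -coset_meanZ; congr (_ / _); apply: eq_bigr => k _.
by rewrite (avg_cell_rec n _ bf) mulrC.
Qed.

Variable e : nat -> R.
Hypothesis e01 : forall j, 0 <= e j <= 1 / 2.
Let e01' j : 0 <= e j < 1.
Proof. by have /andP[-> ?] := e01 j; rewrite /=; lra. Qed.

Definition tail (n : nat) (v : R) : R := - (phi e n v / 3 ^+ n).

Lemma measurable_tail n : measurable_fun setT (tail n : RR -> RR).
Proof.
apply: measurableT_comp => //; apply: measurable_funM => //; exact: measurable_phi.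
Qed.
Hint Resolve measurable_tail : core.

Lemma avg_tail_rec n f u : bdm f ->
  avg (tail n) f u = digit_mean e n (avg (tail n.+1) f) u.
Proof.
move=> bf; have k0 : 3 ^+ n != 0 :> R by rewrite expf_neq0.
have b : bdm (fun x : RR => f (u - x / 3 ^+ n)).
  apply: (@bdm_comp _ _ _ _ _ f (fun x : RR => u - x / 3 ^+ n : RR)) bf.
  by apply: measurable_funB => //; exact: measurable_funM.
rewrite /avg (mean_phi_rec e01' n b) /digit_mean /avg.
congr (_ * _ + _ * _ + _ * _); apply: eq_Rintegral => v _;
  by congr f; rewrite /tail exprS; field.
Qed.

(** The first [n] digits act as digit averages, and the later ones remain together in [tail n]. *)
Lemma avg_tail_means n f u : bdm f ->
  avg (tail 0) f u = digit_means e n (avg (tail n) f) u.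
Proof.
move=> bf; elim: n u => [//|n IH] u.
rewrite IH /=; congr (digit_means e n _ u); apply/funext => x.
exact: avg_tail_rec.
Qed.

(** Haar integrals are integrals of coset means, so the finite inequality can be used at each [u].
    The smoothing, commuted inside, then replaces the coset mean of f^2 by its integral. *)
Lemma avg_tail_cell_hypercontractive n f : bdm f -> periodic1 f ->
  \int[unif R]_u (avg (cell n) (avg (tail 0) f) u ^+ 4) <=
  (\int[unif R]_u (f u ^+ 2)) ^+ 2.
Proof.
move=> bf pf; set h := avg (cell n) f.
have bh : bdm h by exact: bdm_avg.
have ph : periodic1 h by exact: avg_periodic.
have bf2 : bdm (fun x => f x ^+ 2) by exact: bdmX.
have pf2 : periodic1 (fun x => f x ^+ 2) by move=> k x; rewrite pf.
have bh2 : bdm (fun x => h x ^+ 2) by exact: bdmX.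
have -> : avg (cell n) (avg (tail 0) f) = avg (tail 0) h.
  by apply/funext => u; rewrite avgC.
have bt : bdm (avg (tail 0) h) by exact: bdm_avg.
have pt : periodic1 (avg (tail 0) h) by exact: avg_periodic.
rewrite -(@mean_coset_mean n (fun u => avg (tail 0) h u ^+ 4)); last 2 first.
- exact: bdmX.
- by move=> k x; rewrite pt.
rewrite -[leRHS](mean_cst (unif R)); apply: mean_le.
- by apply: bdm_coset_mean; exact: bdmX.
- exact: bdm_cst.
move=> u.
have -> : coset_mean n (fun u => avg (tail 0) h u ^+ 4) u =
    coset_mean n (fun u => digit_means e n (avg (tail n) h) u ^+ 4) u.
  by congr (_ / _); apply: eq_bigr => k _; rewrite (avg_tail_means n).
have pn : periodic1 (avg (tail n) h) by exact: avg_periodic.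
rewrite (le_trans (coset_mean_hypercontractive e01 n u pn))//.
have bn : bdm (avg (cell n) (fun x => f x ^+ 2)) by exact: bdm_avg.
rewrite lerXn2r ?nnegrE//.
- by apply: coset_mean_ge0 => x; exact: sqr_ge0.
- by apply: Rintegral_ge0 => x _; exact: sqr_ge0.
(* Jensen's inequality is applied twice, for the tail and for the smoothing. *)
apply: (@le_trans _ _ 
  (coset_mean n (avg (tail n) (avg (cell n) (fun x => f x ^+ 2))) u)).
  apply: coset_mean_le => x; rewrite (le_trans (avg_sqr_le _ _ _))//.
  by apply: avg_le => // y; exact: avg_sqr_le.
rewrite coset_mean_avg// (_ : coset_mean n _ = fun=> \int[unif R]_u (f u ^+ 2)).
  by rewrite avg_cst.
by apply/funext => x; rewrite coset_mean_cell.
Qed.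

End averages.

(** * Passage to the limit *)

Section differentiation.
Variable R : realType.
Local Notation RR := (measurableTypeR R).
Local Notation mu := (@lebesgue_measure R).

Lemma ae_unif (Q : R -> Prop) : {ae mu, forall x, Q x} -> {ae unif R, forall x, Q x}.
Proof.
move=> [N [mN N0 QN]]; exists N; split => //.
have := dominates_uniform_prob (@ltr01 R).
by move=> /null_content_dominatesP; apply.
Qed.

Lemma bdm_locally_integrable (f : RR -> R) : bdm f -> locally_integrable setT f.
Proof.
move=> [mf [M fM]]; split => [//||K _ cK]; first exact: openT.
have mK : measurable K by apply: closed_measurable; exact: compact_closed.
apply: (@le_lt_trans _ _ (\int[mu]_(x in K) (cst M%:E) x)%E).
  apply: ge0_le_integral => //.
  - by apply/measurable_EFinP; apply: measurableT_comp => //; exact: measurable_funS mf.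
  - by move=> x _; rewrite lee_fin.
rewrite integral_cst//= lte_mul_pinfty//.
  by rewrite lee_fin (le_trans (normr_ge0 (f 0))).
exact: compact_finite_measure.
Qed.

Lemma avg_cellE n (f : RR -> R) u : bdm f -> (forall x, 0 <= f x) ->
  (avg (@cell R n) f u)%:E =
    ((mu (ball u (1 / 2 / 3 ^+ n)))^-1 *
     \int[mu]_(y in ball u (1 / 2 / 3 ^+ n)) (f y)%:E)%E.
Proof.
move=> bf f0; have k0 : 0 < 3 ^+ n :> R by exact: exprn_gt0.
set p : R := (3 ^+ n)^-1; have p0 : 0 < p by rewrite invr_gt0.
set r := 1 / 2 / 3 ^+ n.
have r2 : r *+ 2 = p by rewrite -mulr_natr /r /p; field; rewrite gt_eqF.
have r0 : 0 < r by rewrite divr_gt0.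
have mfE : measurable_fun setT (EFin \o f) by apply/measurable_EFinP; exact: bf.1.
rewrite lebesgue_measure_ball ?(ltW r0)// r2 inver gt_eqF//.
have ba : bdm (fun v : RR => f (u - r + p * v)) by exact: bdm_affine.
have -> : avg (@cell R n) f u = \int[unif R]_v f (u - r + p * v).
  apply: eq_Rintegral => v _; congr f; rewrite /cell -addrA; congr (_ + _).
  by rewrite /r /p; field; rewrite gt_eqF.
rewrite mean_EFin//.
have -> : ball u r = `]u - r, (u - r + p)[%classic.
  rewrite ball_itv; congr [set` Interval _ (BLeft _)].
  by rewrite -r2 mulr2n addrA subrK.
rewrite integral_itv_bndo_bndc; last exact: measurable_funS mfE.
rewrite integral_itv_obnd_cbnd; last exact: measurable_funS mfE.
have := @ge0_integral_affine R (u - r) p (EFin \o f) p0 mfE (fun x => f0 x).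
rewrite /comp => ->.
rewrite muleA -EFinM mulVf ?gt_eqF// mul1e.
apply: integral_unif => [|v]; last by rewrite lee_fin.
by apply/measurable_EFinP; exact: ba.1.
Qed.

(** The Lebesgue differentiation theorem on balls of radius 3^-n / 2, applied to [f + M], since
    [avg_cellE] asks for a nonnegative function. *)
Lemma avg_cell_cvg (f : RR -> R) : bdm f ->
  {ae unif R, forall u, avg (@cell R n) f u @[n --> \oo] --> f u}.
Proof.
move=> bf; have [mf [M fM]] := bf; apply: ae_unif.
have bM : bdm (fun x => f x + M) by apply: bdmD => //; exact: bdm_cst.
have M0 x : 0 <= f x + M by have := fM x; rewrite ler_norml => /andP[? _]; lra.
have liM := bdm_locally_integrable bM.
pose r n : R := 1 / 2 / 3 ^+ n.
have r0 n : 0 < r n by rewrite divr_gt0// exprn_gt0.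
pose E x n : set R := ball x (r n).
have hE x : nicely_shrinking x (E x).
  split=> [n|]; first exact: measurable_ball.
  exists (1, fun n => PosNum (r0 n)); split => //=.
  - have : (1 / 2 : R) * (1 / 3) ^+ n @[n --> \oo] --> (1 / 2 : R) * 0.
      by apply: cvgM; [exact: cvg_cst | apply: cvg_expr; rewrite ger0_norm//; lra].
    rewrite mulr0; apply: cvg_trans; apply: near_eq_cvg; apply: nearW => n.
    by rewrite /r /= expr_div_n expr1n mulrA mulr1.
  - by move=> n; exact: subset_refl.
  - by move=> n; rewrite mul1e.
have := lebesgue_differentiation liM.
apply: (filterS (F := almost_everywhere mu)) => x hx.
have Ea n : avg (@cell R n) (fun y => f y + M) x = avg (@cell R n) f x + M.
  rewrite /avg meanD ?mean_cst//; last exact: bdm_cst.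
  by apply: bdm_addl => //; exact: measurable_cell.
have := nice_lebesgue_differentiation hE liM hx.
have -> : (fun n => (mu (E x n))^-1 * \int[mu]_(y in E x n) (f y + M)%:E)%E =
    (fun n => (avg (@cell R n) f x + M)%:E).
  by apply/funext => n; rewrite -Ea avg_cellE.
move=> /fine_cvgP[_] h; have {}h := cvgB h (cvg_cst M).
have F : Filter (\oo : set_system nat) by exact: _.
have {}h := h F F.
rewrite -[f x](addrK M); apply: (cvg_trans _ h).
by apply: near_eq_cvg; apply: nearW => n /=; rewrite fctE /= addrK.
Qed.

Lemma fatou_bound d (X : measurableType d) (P : probability X R)
    (h_ : nat -> X -> R) (h : X -> R) (C : R) :
  (forall n, measurable_fun setT (h_ n)) -> measurable_fun setT h ->
  {ae P, forall x, h_ n x @[n --> \oo] --> h x} ->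
  (forall n, (\int[P]_x ((h_ n x) ^+ 4)%:E <= C%:E)%E) ->
  (\int[P]_x ((h x) ^+ 4)%:E <= C%:E)%E.
Proof.
move=> mh_ mh hh hC.
have m4 (f : X -> R) : measurable_fun setT f ->
    measurable_fun setT (fun x => (f x ^+ 4)%:E).
  by move=> mf; apply/measurable_EFinP; exact: measurable_funX.
have p4 (y : R) : (0 <= (y ^+ 4)%:E)%E by rewrite lee_fin exprn_even_ge0.
apply: (@le_trans _ _ (\int[P]_x limn_einf (fun n => (h_ n x ^+ 4)%:E))%E).
  apply: ae_ge0_le_integral => //.
  - exact: m4.
  - move=> x _; rewrite limn_einf_lim; apply: lime_ge; first exact: is_cvg_einfs.
    by apply: nearW => n; apply: le_ereal_inf_tmp => _ [k _ <-].
  (* The lower limit is minus the upper limit of the opposites, whose measurability is known. *)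
  - apply: (@measurableT_comp _ _ _ _ _ _ (-%E : \bar R -> \bar R)) => //.
    apply: (@measurable_fun_limn_esup _ _ _ setT (fun n x => - (h_ n x ^+ 4)%:E)%E) => n.
    by apply: measurableT_comp => //; exact: m4.
  apply: filterS hh => x hx _.
  have : (h_ n x ^+ 4)%:E @[n --> \oo] --> (h x ^+ 4)%:E.
    apply: cvg_EFin; first exact: nearW.
    apply: (@cvg_comp _ _ _ _ (fun y : R => y ^+ 4) _ _ _ hx).
    exact: exprn_continuous.
  by move=> c; rewrite is_cvg_limn_einfE ?(cvg_lim _ c)//; exact: cvgP c.
apply: (le_trans (fatou _ _ _ _)) => //.
- by move=> n; exact: m4.
rewrite limn_einf_lim; apply: lime_le; first exact: is_cvg_einfs.
apply: nearW => n; apply: ereal_inf_le => //=.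
by exists (\int[P]_x ((h_ n x) ^+ 4)%:E)%E => //; exists n => //=.
Qed.

Variable e : nat -> R.
Hypothesis e01 : forall j, 0 <= e j <= 1 / 2.

Lemma avg_tail_bound (f : RR -> R) (C : R) : bdm f -> periodic1 f ->
  \int[unif R]_u (f u ^+ 2) <= C ->
  (\int[unif R]_u ((avg (tail e 0) f u) ^+ 4)%:E <= (C ^+ 2)%:E)%E.
Proof.
move=> bf pf fC.
have bt : bdm (avg (tail e 0) f) by apply: bdm_avg => //; exact: measurable_tail.
apply: (@fatou_bound _ _ (unif R) (fun n => avg (@cell R n) (avg (tail e 0) f))).
- by move=> n; apply: (bdm_avg _ bt).1; exact: measurable_cell.
- exact: bt.1.
- exact: avg_cell_cvg.
move=> n; rewrite -mean_EFin; last first.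
  by apply: bdmX; apply: bdm_avg => //; exact: measurable_cell.
rewrite lee_fin (le_trans (avg_tail_cell_hypercontractive e01 n bf pf))//.
have f0 : 0 <= \int[unif R]_u (f u ^+ 2).
  by apply: Rintegral_ge0 => x _; exact: sqr_ge0.
by rewrite lerXn2r ?nnegrE// (le_trans f0).
Qed.

End differentiation.

(** * From bounded functions to L^2 *)

Section hyperbounded.
Variable R : realType.
Local Notation RR := (measurableTypeR R).
Local Notation T := (circle R).
Local Notation haar := (@Defs.haar R).
Local Notation tail := (tail (@bias R) 0).

(** Positive and negative parts are transported separately, without integrability:
    [convop_digit_measure] can thus hold at every point, even where the integral diverges and
    [Rintegral] takes its default value. *)
Lemma integral_distribution_measurable d d' (X : measurableType d)
    (Y : measurableType d') (P : probability X R) (phi : {mfun X >-> Y})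
    (f : Y -> \bar R) : measurable_fun setT f ->
  (\int[distribution P phi]_y f y = \int[P]_x f (phi x))%E.
Proof.
move=> mf; rewrite integralE [RHS]integralE; congr (_ - _)%E.
  rewrite ge0_integral_distribution//; last exact: measurable_funepos.
  by rewrite -funepos_comp.
rewrite ge0_integral_distribution//; last exact: measurable_funeneg.
by rewrite -funeneg_comp.
Qed.

Variable F : T -> R.
Hypothesis mF : measurable_fun setT F.
Hypothesis F2 : (\int[haar]_x (F x ^+ 2)%:E < +oo)%E.

Let f (u : RR) : R := F (angle u).

Let mf : measurable_fun setT f.
Proof. exact: (measurableT_comp mF (@measurable_angle R)). Qed.

Let pf : periodic1 f.
Proof. by move=> k u; rewrite /f angle_periodic. Qed.

Let mf2 : measurable_fun setT (fun u : RR => (f u ^+ 2)%:E).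
Proof. by apply/measurable_EFinP; exact: measurable_funX. Qed.

Let mfabs : measurable_fun setT (fun u : RR => `|(f u)%:E|%E).
Proof. by apply: measurableT_comp => //; exact/measurable_EFinP. Qed.

Let f2 : (\int[unif R]_u (f u ^+ 2)%:E < +oo)%E.
Proof.
rewrite -(@integral_haar R (fun x => (F x ^+ 2)%:E))//.
- by apply/measurable_EFinP; exact: measurable_funX.
- by move=> x; rewrite lee_fin sqr_ge0.
Qed.

Let C : R := fine (\int[unif R]_u (f u ^+ 2)%:E)%E.

Let CE : (\int[unif R]_u (f u ^+ 2)%:E = C%:E)%E.
Proof.
by rewrite fineK// ge0_fin_numE// integral_ge0// => x _; rewrite lee_fin sqr_ge0.
Qed.

Let f1 : (\int[unif R]_u `|(f u)%:E| < +oo)%E.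
Proof.
apply: (@le_lt_trans _ _ (\int[unif R]_u ((1%:E) + (f u ^+ 2)%:E))%E).
  apply: ge0_le_integral => //.
  - by apply: emeasurable_funD.
  - move=> x _; rewrite -EFinD lee_fin -(real_normK (num_real (f x))).
    by have := normr_ge0 (f x); nra.
rewrite ge0_integralD//; last by move=> x _; rewrite lee_fin sqr_ge0.
rewrite CE integral_cst// mul1e lte_add_pinfty ?ltry//.
exact: fin_num_fun_lty.
Qed.

Let mpair : measurable_fun setT (fun z : RR * RR => (f (z.1 + tail z.2))%:E).
Proof.
apply/measurable_EFinP; apply: (measurableT_comp mf).
apply: measurable_funD => //; apply: measurableT_comp => //.
exact: measurable_tail.
Qed.

(** By Tonelli, integrating in [u] first: translation invariance reduces the inner integral to that
    of [|f|]. Hence the average defining [g] converges absolutely for almost every [u]. *)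
Let ipair : ((unif R \x unif R)%E).-integrable setT
  (fun z : RR * RR => (f (z.1 + tail z.2))%:E).
Proof.
apply/(integrable21ltyP _ _ mpair) => /=.
under eq_integral => v _.
  under eq_integral do rewrite addrC.
  rewrite (@unif_translate R (fun u => `|(f u)%:E|%E))//; last first.
    by move=> k u; rewrite pf.
  over.
rewrite integral_cst//= lte_mul_pinfty ?integral_ge0//; last exact: fin_num_fun_lty.
by rewrite ge0_fin_numE// integral_ge0.
Qed.

Let g : RR -> R := avg tail f.

Let mg : measurable_fun setT g.
Proof. by apply: measurableT_comp => //; exact: (measurable_fubini_F ipair). Qed.

Let trunc (n : nat) (x : R) : R := if `|x| <= n%:R then x else 0.

Let trunc_le n x : `|trunc n x| <= n%:R.
Proof. by rewrite /trunc; case: ifP => //; rewrite normr0. Qed.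

Let trunc_norm n x : `|trunc n x| <= `|x|.
Proof. by rewrite /trunc; case: ifP => //; rewrite normr0. Qed.

Let trunc_cvg x : trunc n x @[n --> \oo] --> x.
Proof.
apply: cvg_near_cst; exists (Num.truncn `|x|).+1 => // n /= hn.
rewrite /trunc ifT//; apply: ltW; apply: (lt_le_trans (truncnS_gt _)).
by rewrite ler_nat.
Qed.

Let btrunc n : bdm (fun u : RR => trunc n (f u)).
Proof.
split; last by exists n%:R => x; exact: trunc_le.
apply: measurable_fun_ifT => //; apply: measurable_fun_ler => //.
exact: measurableT_comp.
Qed.

(** The bounded case applies to the truncations of [f], with the same constant. Their averages
    converge to [g] almost everywhere by dominated convergence, and Fatou's lemma passes to the
    limit. *)
Lemma avg_tail_integral_le : (\int[unif R]_u (g u ^+ 4)%:E <= (C ^+ 2)%:E)%E.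
Proof.
have e01 j : 0 <= @bias R j <= 1 / 2 by rewrite (ltW (bias_gt0 R j)) bias_le_half.
apply: (@fatou_bound R _ RR (unif R)
  (fun n => avg tail (fun u => trunc n (f u))) g) => //.
- by move=> n; apply: (bdm_avg _ (btrunc n)).1; exact: measurable_tail.
- apply: (filterS (F := almost_everywhere (unif R)) _ (ae_integrable1 ipair)) => u /= iu.
  have mtail : measurable_fun setT (fun v : RR => u + tail v : RR).
    by apply: measurable_funD => //; exact: measurable_tail.
  have bt n : bdm (fun v : RR => trunc n (f (u + tail v))).
    exact: (bdm_comp mtail (btrunc n)).
  have cvgt v : (trunc n (f (u + tail v)))%:E @[n --> \oo] --> (f (u + tail v))%:E.
    by apply: cvg_EFin; [exact: nearW | exact: trunc_cvg].
  have [] := @dominated_convergence _ _ _ (unif R) setT measurableT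
    (fun n v => (trunc n (f (u + tail v)))%:E) (fun v => (f (u + tail v))%:E)
    (fun v => `|(f (u + tail v))%:E|%E).
  + by move=> n; apply/measurable_EFinP; exact: (bt n).1.
  + by apply/measurable_EFinP; exact: (measurableT_comp mf mtail).
  + by apply: aeW => v _; exact: cvgt.
  + exact: integrable_abse.
  + by apply: aeW => v n _; rewrite lee_fin trunc_norm.
  move=> i2 _ /=; rewrite -[X in _ --> X]fineK; last exact: integrable_fin_num.
  by move=> /fine_cvgP[].
- move=> n; apply: avg_tail_bound => //.
    by move=> k u; rewrite pf.
  rewrite -lee_fin mean_EFin; last exact: bdmX.
  rewrite -CE; apply: ge0_le_integral => //.
  + by move=> x _; rewrite lee_fin sqr_ge0.
  + by apply/measurable_EFinP; exact: (bdmX 2 (btrunc n)).1.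
  + move=> x _; rewrite lee_fin -(real_normK (num_real (f x))).
    rewrite -(real_normK (num_real (trunc _ _))) lerXn2r ?nnegrE//.
Qed.

Lemma convop_digit_measure u : convop (digit_measure R) F (angle u) = g u.
Proof.
have m u' : measurable_fun setT (fun y : T => (F (angle u' - y))%:E).
  apply/measurable_EFinP; apply: (measurableT_comp mF).
  apply: (measurableT_comp (@measurable_wrap R)); apply: measurable_funD => //.
  apply: (measurableT_comp (@measurable_cval R)).
  apply: (measurableT_comp (@measurable_wrap R)); apply: measurableT_comp => //.
  exact: measurable_cval.
rewrite /convop /Rintegral integral_distribution_measurable//.
congr fine; apply: eq_integral => v _; congr (F _)%:E.
by rewrite /digit_point -angleB /tail expr0 divr1.
Qed.

Lemma convop_angle x : convop (digit_measure R) F x = g (cval x / (2 * pi)).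
Proof.
rewrite -convop_digit_measure /angle mulrC mulfVK ?cvalK//.
by rewrite mulf_neq0// gt_eqF// pi_gt0.
Qed.

Lemma convop_Lfun4 : convop (digit_measure R) F \in Lfun haar 4%:E.
Proof.
have mconv : measurable_fun setT (convop (digit_measure R) F).
  under [X in measurable_fun _ X]funext do rewrite convop_angle.
  apply: (measurableT_comp mg); apply: measurable_funM => //.
  exact: measurable_cval.
rewrite inE; apply/andP; split; rewrite inE//= /finite_norm unlock.
apply: poweR_lty.
apply: (@le_lt_trans _ _ (\int[haar]_x (convop (digit_measure R) F x ^+ 4)%:E)%E).
  rewrite le_eqVlt; apply/orP; left; apply/eqP; apply: eq_integral => x _ /=.
  by rewrite powR_mulrn// -normrX ger0_norm// exprn_even_ge0.
rewrite integral_haar.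
- under eq_integral do rewrite convop_digit_measure.
  by rewrite (le_lt_trans avg_tail_integral_le)// ltry.
- by apply/measurable_EFinP; exact: measurable_funX.
- by move=> x; rewrite lee_fin exprn_even_ge0.
Qed.

End hyperbounded.

Lemma hyperbounded_digit_measure (R : realType) : hyperbounded (digit_measure R).
Proof.
exists 2%:E, 4%:E; split; [by rewrite lte_fin ltr1n|by rewrite lte_fin ltr_nat|].
move=> F hF; have F2 := Lfun2_integrable_sqr hF.
apply: convop_Lfun4.
  by move: hF; rewrite inE => /andP[+ _]; rewrite inE.
have /integrableP[_] := F2; apply: le_lt_trans.
rewrite le_eqVlt; apply/orP; left; apply/eqP; apply: eq_integral => x _ /=.
by rewrite ger0_norm// sqr_ge0.
Qed.

Theorem theorem6p2 (R : realType) :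
  exists nu : probability (circle R) R,
    [/\ singular nu,
        rajchman nu,
        (forall k : nat, (1 <= k)%N -> singular (convpow nu k)),
        ~ harris nu
      & hyperbounded nu].
Proof.
exists (digit_measure R); split.
- exact: singular_digit_measure.
- exact: rajchman_digit_measure.
- exact: singular_convpow.
- by move=> [k k1]; apply; exact: singular_convpow.
- exact: hyperbounded_digit_measure.
Qed.
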